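(* Let $\mathcal{H}$ be a separable complex Hilbert space and let $S:\mathcal{H}\supset\operatorname{dom}S\to\mathcal{H}$ be a closed, symmetric, densely defined operator for which there exists $\mu>0$ with $(Sf,f)\ge\mu\|f\|^2$ for all $f\in\operatorname{dom}S$. Let $\mathcal{H}_S$ denote $\operatorname{dom}S$ equipped with the norm $\|f\|_S:=\|Sf\|$, and assume that the embedding $\iota:\mathcal{H}_S\to\mathcal{H}$ is compact. Then the spectrum $\sigma(S_{\rm K})$ of the Krein–von Neumann extension $S_{\rm K}$ of $S$ is nonnegative and consists of isolated eigenvalues, and the positive eigenvalues have finite multiplicities. Moreover, counted with multiplicities, the positive eigenvalues $\lambda_1^+(S_{\rm K})\le\lambda_2^+(S_{\rm K})\le\dots$ of $S_{\rm K}$ satisfy $$\lambda_j^+(S_{\rm K})=\min_{\substack{F\subset\operatorname{dom}S\\ \dim F=j}}\ \max_{\substack{f\in F\\ f\neq0}}\ \frac{\|Sf\|^2}{(Sf,f)}$$ for all $j\in\mathbb{N}$ (with $j\le\dim\mathcal{H}$ if $\mathcal{H}$ is finite-dimensional).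
   Context: The Krein–von Neumann extension $S_{\rm K}$ of $S$ is the self-adjoint operator $S_{\rm K}f=S^*f$, $\operatorname{dom}S_{\rm K}=\operatorname{dom}S\dotplus\ker S^*$ (direct sum), where $S^*$ is the adjoint of $S$. $F$ ranges over linear subspaces of $\operatorname{dom}S$. *)

(* Defs.v *)
From HB Require Import structures.
From mathcomp Require Import all_boot all_order all_algebra.
From mathcomp Require Import complex.
From mathcomp Require Import all_classical all_reals all_analysis.

Set Implicit Arguments.
Unset Strict Implicit.
Unset Printing Implicit Defensive.

Import Order.TTheory GRing.Theory Num.Theory.
Import numFieldNormedType.Exports.

Local Open Scope classical_set_scope.
Local Open Scope ring_scope.

(* The complex scalars are [R[i]] for [R : realType].  Its order is partial:
   [x <= y] says that [y - x] is real and nonnegative.  In particular [0 <= x]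
   and [0 < x] assert that [x] is real, so real quantities need no separate
   embedding of [R]. *)

Definition is_min d (T : porderType d) (A : set T) (m : T) : Prop :=
  A m /\ lbound A m.

Definition is_max d (T : porderType d) (A : set T) (m : T) : Prop :=
  A m /\ ubound A m.

Definition separable_space (T : topologicalType) : Prop :=
  exists2 A : set T, countable A & dense A.

Section Dimension.
Context {K : fieldType} {V : lmodType K}.

Definition lin_indep n (v : 'I_n -> V) : Prop :=
  forall c : 'I_n -> K, \sum_(i < n) c i *: v i = 0 -> forall i, c i = 0.

Definition lin_span n (v : 'I_n -> V) : set V :=
  [set x | exists c : 'I_n -> K, x = \sum_(i < n) c i *: v i].

(* Entails that [F] is a linear subspace. *)
Definition has_dim (F : set V) (n : nat) : Prop :=
  exists v : 'I_n -> V, lin_indep v /\ F = lin_span v.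

End Dimension.

(* A possibly unbounded operator in [V]; the values of [op_fun] outside
   [op_dom] are irrelevant. *)
Record operator (V : Type) : Type := Operator {
  op_dom : set V;
  op_fun :> V -> V
}.

Definition linear_operator (K : fieldType) (V : lmodType K) (T : operator V)
    : Prop :=
  op_dom T 0 /\
  forall (a : K) (f g : V), op_dom T f -> op_dom T g ->
    op_dom T (a *: f + g) /\ T (a *: f + g) = a *: T f + T g.

Section Operators.
Context {R : realType} {H : completeNormedModType R[i]}.

Definition densely_defined (T : operator H) : Prop := dense (op_dom T).

Definition closed_operator (T : operator H) : Prop :=
  closed [set p : H * H | op_dom T p.1 /\ p.2 = T p.1].

Definition op_ker (T : operator H) : set H :=
  [set f | op_dom T f /\ T f = 0].

(* The linear map [iota f = f] from [dom T], normed by [`|T f|], to [H] sends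
   the closed unit ball to a relatively compact set. *)
Definition compact_embedding (T : operator H) : Prop :=
  precompact [set f : H | op_dom T f /\ `|T f| <= 1].

Definition op_eigenspace (T : operator H) (l : R[i]) : set H :=
  [set f | op_dom T f /\ T f = l *: f].

Definition op_eigenvalue (T : operator H) (l : R[i]) : Prop :=
  exists2 f, f != 0 & op_eigenspace T l f.

(* [R[i]^o] is [R[i]] with the topology of its norm. *)
Definition resolvent_set (T : operator H) : set R[i]^o :=
  [set l : R[i] |
    set_bij (op_dom T) [set: H] (fun f => T f - l *: f) /\
    exists M : R[i], forall f, op_dom T f -> `|f| <= M * `|T f - l *: f| ].

Definition spectrum (T : operator H) : set R[i]^o := ~` resolvent_set T.

(* [lam], restricted to the index set [J], lists the positive eigenvalues of
   [T] in nondecreasing order, each as often as its multiplicity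
   [dim (ker (T - l))].  For [n = 0], the last clause says that a positive
   number that is not an eigenvalue is not listed. *)
Definition enumerates_positive_eigenvalues (T : operator H) (J : set nat)
    (lam : nat -> R[i]) : Prop :=
  [/\ forall j, J j -> 0 < lam j,
      forall i j, J i -> J j -> (i <= j)%N -> lam i <= lam j
    & forall l : R[i], 0 < l -> exists n : nat,
        has_dim (op_eigenspace T l) n /\
        ([set j | J j /\ lam j = l] #= `I_n)%card ].

End Operators.

(* The indices j = 1, 2, ..., up to [dim V] if [V] has finite dimension. *)
Definition index_upto_dim (K : fieldType) (V : lmodType K) : set nat :=
  [set j | (0 < j)%N /\ forall n : nat, has_dim [set: V] n -> (j <= n)%N].

Section InnerProduct.
Context {R : realType} {H : completeNormedModType R[i]}.

(* [dot] is linear in its first and conjugate-linear in its second argument. *)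
Variable dot : {dot H for Num.conj}.

(* Makes the Banach space [H] a Hilbert space with inner product [dot]. *)
Definition induces_norm : Prop := forall f : H, `|f| ^+ 2 = dot f f.

Definition symmetric_operator (T : operator H) : Prop :=
  forall f g, op_dom T f -> op_dom T g -> dot (T f) g = dot f (T g).

Definition lower_bounded (T : operator H) (mu : R[i]) : Prop :=
  forall f, op_dom T f -> mu * `|f| ^+ 2 <= dot (T f) f.

Definition adjoint_at (T : operator H) (g h : H) : Prop :=
  forall f, op_dom T f -> dot (T f) g = dot f h.

(* The [h] chosen by [xget] is unique when [T] is densely defined. *)
Definition adjoint (T : operator H) : operator H :=
  Operator [set g | exists h, adjoint_at T g h]
           (fun g => xget 0 (adjoint_at T g)).

(* The sum defining the domain is direct when [T] is symmetric and bounded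
   from below by a positive constant. *)
Definition krein_von_neumann (T : operator H) : operator H :=
  Operator [set f + g | f in op_dom T & g in op_ker (adjoint T)] (adjoint T).

Definition quotients (T : operator H) (F : set H) : set R[i] :=
  [set `|T f| ^+ 2 / dot (T f) f | f in [set f | F f /\ f != 0]].

End InnerProduct.

(* Main.v *)
Require Import Defs.
From HB Require Import structures.
From mathcomp Require Import all_boot all_order all_algebra.
From mathcomp Require Import complex ring lra.
From mathcomp Require Import all_classical all_reals all_analysis.
Set Implicit Arguments.
Unset Strict Implicit.
Unset Printing Implicit Defensive.
Import Order.TTheory GRing.Theory Num.Theory.
Import numFieldNormedType.Exports.
Local Open Scope classical_set_scope.
Local Open Scope ring_scope.
Local Open Scope complex_scope.

(** The theorem is the spectral theorem for one compact operator, read through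
    a change of variables.

    Since [S >= mu > 0] is closed, [S] is injective with closed range and [H]
    is the orthogonal sum of [ran S] and [ker S^*].  Let [P] be the orthogonal
    projection onto [ran S], and [K := P S^-1 P], an operator defined on all of
    [H].  It is bounded and selfadjoint, it is nonnegative because
    [(K (S f), S f) = (f, S f)], and it is compact because [S^-1] maps bounded
    sets to bounded sets of [dom S] with the norm [|S f|], which embeds
    compactly into [H] ([compression]).  The graph of the Krein-von Neumann
    extension can be described by [P] and [K] alone ([krein_graph]):
    [S_K u = w] if and only if [P w = w] and [P u = K w].  All that concerns
    [S_K] follows from this.  For [l != 0], [S_K u = l u] is equivalent to
    [K u = l^-1 u] ([krein_eigenspace]), and [l] is in the resolvent set as
    soon as [l^-1] is not an eigenvalue of [K], by the Fredholm alternative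
    ([fredholm], [resolvent_nonzero]).  The point [0] is in the spectrum only
    if [ker S^*] is nonzero, and then it is an eigenvalue ([resolvent_zero]).

    The eigenvalues of [K] are listed by exhaustion: maximize the form
    [(K x, x)] over the unit ball of the orthogonal complement of the
    eigenvectors found so far; compactness makes the supremum an eigenvalue
    ([max_eigen], [spectral_sequence]).  This gives eigenvalues [kap 0 >= kap 1
    >= ...] with orthonormal eigenvectors [e i] for as long as they are
    positive.  Compactness also forces [kap n] to tend to [0], so each positive
    eigenvalue occupies a finite block of indices whose length is its
    multiplicity ([kap_small], [eigenspace_span]), and the values [1 / kap i]
    are isolated.  They are the positive eigenvalues of [S_K].  The list of
    positive [kap i] has exactly [dim H] members: if it stopped at [n], then
    [dom S] would have dimension [n], hence be closed, hence be [H]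
    ([index_kap]).

    For the minimax formula put [x := S f]; then
    [|S f|^2 / (S f, f) = |x|^2 / (K x, x)].  On the span of the preimages of
    [e 0, ..., e i] this is at most [1 / kap i] ([quotient_le_span]), and any
    subspace of dimension [i + 1] of [dom S] contains an [f != 0] with [S f]
    orthogonal to [e 0, ..., e (i - 1)], where it is at least [1 / kap i]
    ([quotient_span_ge]).  The maximum over a given finite-dimensional subspace
    is attained, again by the compact embedding ([quotient_max]).

    Norms and inner products live in the partially ordered field [R[i]].
    Estimates are done in [R], with the real parts [rnorm] and [rdot]. *)

(** * Real parts of the norm and of the inner product *)

Section RealPart.
Context {R : realType} {H : completeNormedModType R[i]}.
Variable dot : {dot H for Num.conj}.
Hypothesis hdot : induces_norm dot.
Implicit Types x y z : H.

Definition rnorm x : R := complex.Re `|x|.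
Definition rdot x y : R := complex.Re (dot x y).

Lemma rnormE x : `|x| = (rnorm x)%:C.
Proof. by rewrite /rnorm RRe_real// ger0_real. Qed.

Lemma rnorm_ge0 x : 0 <= rnorm x.
Proof. by rewrite -ler0c -rnormE. Qed.

Lemma rnormD x y : rnorm (x + y) <= rnorm x + rnorm y.
Proof. by rewrite -lecR rmorphD/= -!rnormE ler_normD. Qed.

Lemma rnormN x : rnorm (- x) = rnorm x.
Proof. by rewrite /rnorm normrN. Qed.

Lemma rnormBC x y : rnorm (x - y) = rnorm (y - x).
Proof. by rewrite -rnormN opprB. Qed.

Lemma rnorm0 : rnorm 0 = 0.
Proof. by rewrite /rnorm normr0. Qed.

Lemma rnorm_eq0 x : (rnorm x == 0) = (x == 0).
Proof. by rewrite -[RHS]normr_eq0 rnormE -(inj_eq (@complexI R)). Qed.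

Lemma rnorm_gt0 x : (0 < rnorm x) = (x != 0).
Proof. by rewrite lt0r rnorm_eq0 rnorm_ge0 andbT. Qed.

Lemma rnormZ (a : R[i]) x : rnorm (a *: x) = complex.Re `|a| * rnorm x.
Proof.
by apply: complexI; rewrite -rnormE normrZ rnormE -[in LHS](RRe_real (normr_real a)) -rmorphM.
Qed.

Lemma rnormZr (a : R) x : rnorm (a%:C *: x) = `|a| * rnorm x.
Proof. by rewrite rnormZ normc_def/= expr0n/= addr0 sqrtr_sqr. Qed.

Lemma dotC x y : dot x y = (dot y x)^*%C.
Proof. by rewrite hermC expr0 mul1r. Qed.

Lemma rdotC x y : rdot x y = rdot y x.
Proof. by rewrite /rdot dotC; case: (dot y x). Qed.

Lemma ReD (a b : R[i]) : complex.Re (a + b) = complex.Re a + complex.Re b.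
Proof. by case: a b => [? ?] [? ?]. Qed.

Lemma ReN (a : R[i]) : complex.Re (- a) = - complex.Re a.
Proof. by case: a. Qed.

Lemma ReZ (a : R) (b : R[i]) : complex.Re (a%:C * b) = a * complex.Re b.
Proof. by case: b => p q /=; rewrite mul0r subr0. Qed.

Lemma rdotDl x y z : rdot (x + y) z = rdot x z + rdot y z.
Proof. by rewrite /rdot linearDl ReD. Qed.
Lemma rdotDr x y z : rdot z (x + y) = rdot z x + rdot z y.
Proof. by rewrite /rdot linearDr ReD. Qed.
Lemma rdotNl x z : rdot (- x) z = - rdot x z.
Proof. by rewrite /rdot linearNl ReN. Qed.
Lemma rdotNr x z : rdot z (- x) = - rdot z x.
Proof. by rewrite /rdot linearNr ReN. Qed.
Lemma rdotBl x y z : rdot (x - y) z = rdot x z - rdot y z.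
Proof. by rewrite rdotDl rdotNl. Qed.
Lemma rdotBr x y z : rdot z (x - y) = rdot z x - rdot z y.
Proof. by rewrite rdotDr rdotNr. Qed.
Lemma rdotZl (a : R) x z : rdot (a%:C *: x) z = a * rdot x z.
Proof. by rewrite /rdot linearZl_LR ReZ. Qed.
Lemma rdotZr (a : R) x z : rdot z (a%:C *: x) = a * rdot z x.
Proof. by rewrite rdotC rdotZl rdotC. Qed.

Lemma rdotxx x : rdot x x = rnorm x ^+ 2.
Proof. by rewrite /rdot -hdot rnormE -rmorphXn. Qed.

Lemma dotxx x : dot x x = (rnorm x ^+ 2)%:C.
Proof. by rewrite -hdot rnormE -rmorphXn. Qed.

Lemma rnorm_sqrB x y : rnorm (x - y) ^+ 2 = rnorm x ^+ 2 - 2 * rdot x y + rnorm y ^+ 2.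
Proof. by rewrite -!rdotxx rdotBl !rdotBr (rdotC y x); ring. Qed.

Lemma rnorm_sqrD x y : rnorm (x + y) ^+ 2 = rnorm x ^+ 2 + 2 * rdot x y + rnorm y ^+ 2.
Proof. by rewrite -!rdotxx rdotDl !rdotDr (rdotC y x); ring. Qed.

(** Cauchy-Schwarz, from the square of the norm of [|y| x - |x| y]. *)
Lemma rdot_le x y : rdot x y <= rnorm x * rnorm y.
Proof.
have [->|x0] := eqVneq x 0; first by rewrite rnorm0 mul0r /rdot linear0l.
have [->|y0] := eqVneq y 0; first by rewrite rnorm0 mulr0 /rdot linear0r.
move: x0 y0; rewrite -!rnorm_gt0 => x0 y0.
have := sqr_ge0 (rnorm ((rnorm y)%:C *: x - (rnorm x)%:C *: y)).
rewrite rnorm_sqrB !rnormZr !(gtr0_norm x0, gtr0_norm y0) rdotZl rdotZr => h.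
rewrite -subr_ge0 -(pmulr_rge0 _ (mulr_gt0 x0 y0)) -(pmulr_rge0 _ (ltr0Sn R 1)).
by apply: le_trans h _; apply/eqP/eqP; lra.
Qed.

(** The imaginary part is recovered by rotating the second argument, so that
    complex orthogonality to a subspace can be tested with [rdot]. *)
Lemma dot_rdot x y : dot x y = (rdot x y)%:C + 'i * (rdot x ('i *: y))%:C.
Proof.
rewrite {1}[dot x y]complexE; congr (_ + _ * _%:C).
rewrite /rdot linearZr_LR -[RHS]/(complex.Re ('i^* * dot x y)%C) /=.
by case: (dot x y) => p q /=; rewrite mul0r mulN1r opprK add0r.
Qed.

Lemma dot0P x y : rdot x y = 0 -> rdot x ('i *: y) = 0 -> dot x y = 0.
Proof. by move=> h1 h2; rewrite dot_rdot h1 h2 mulr0 addr0. Qed.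

Lemma rdot_eq0 x y : dot x y = 0 -> rdot x y = 0.
Proof. by rewrite /rdot => ->. Qed.

Lemma dotDl x y z : dot (x + y) z = dot x z + dot y z.
Proof. exact: linearDl. Qed.
Lemma dotBl x y z : dot (x - y) z = dot x z - dot y z.
Proof. exact: linearBl. Qed.
Lemma dotZl a x z : dot (a *: x) z = a * dot x z.
Proof. exact: linearZl_LR. Qed.
Lemma dotBr x y z : dot z (x - y) = dot z x - dot z y.
Proof. exact: linearBr. Qed.
Lemma dotZr a x z : dot z (a *: x) = a^*%C * dot z x.
Proof. exact: linearZr_LR. Qed.
Lemma dot_suml (I : Type) (r : seq I) (P : pred I) (F : I -> H) z :
  dot (\sum_(i <- r | P i) F i) z = \sum_(i <- r | P i) dot (F i) z.
Proof. exact: linear_sumlz. Qed.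

Lemma dotC0 x y : dot x y = 0 -> dot y x = 0.
Proof. by rewrite dotC => h; rewrite -[dot y x]conjcK h conjc0. Qed.

(** Multiplying [x] by a phase makes [(x, y)] real and nonnegative, which
    reduces the complex Cauchy-Schwarz inequality to the real one. *)
Lemma dot_le x y : complex.Re `|dot x y| <= rnorm x * rnorm y.
Proof.
have [->|d0] := eqVneq (dot x y) 0.
  by rewrite normr0 mulr_ge0 ?rnorm_ge0.
pose a : R[i] := (dot x y)^*%C / `|dot x y|.
have n0 : `|dot x y| != 0 by rewrite normr_eq0.
have -> : complex.Re `|dot x y| = rdot (a *: x) y.
  rewrite /rdot linearZl_LR/= /a mulrAC [_^*%C * _]mulrC -sqr_normc expr2.
  by rewrite -mulrA mulfV// mulr1.
apply: le_trans (rdot_le _ _) _.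
rewrite rnormZ /a normrM normrV ?unitfE// normr_id normcJ mulfV//.
by rewrite mul1r.
Qed.

Lemma dot_nondeg x : (forall y, dot x y = 0) -> x = 0.
Proof.
by move=> /(_ x); rewrite dotxx => /complexI/eqP; rewrite sqrf_eq0 rnorm_eq0 => /eqP.
Qed.

Lemma pythagoras x y : dot x y = 0 -> rnorm (x + y) ^+ 2 = rnorm x ^+ 2 + rnorm y ^+ 2.
Proof. by move=> h; rewrite rnorm_sqrD rdot_eq0// mulr0 addr0. Qed.

Lemma pythagorasB x y : dot x y = 0 -> rnorm (x - y) ^+ 2 = rnorm x ^+ 2 + rnorm y ^+ 2.
Proof. by move=> h; rewrite rnorm_sqrB rdot_eq0// mulr0 subr0. Qed.

(** * Convergence of sequences in terms of the real norm *)

Lemma rnorm_cvgP (u : nat -> H) x :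
  (u @ \oo --> x) <->
    (forall e : R, 0 < e -> exists N, forall n, (N <= n)%N -> rnorm (u n - x) < e).
Proof.
split=> [/cvgrPdist_lt h e e0|h].
  have e0' : 0 < e%:C by rewrite ltcR.
  have [N _ hN] := h _ e0'.
  exists N => n Nn; rewrite rnormBC; have := hN n Nn; rewrite /= rnormE ltcR//.
apply/cvgrPdist_lt => e e0.
have ee : e = (complex.Re e)%:C by rewrite RRe_real// gtr0_real.
rewrite ee in e0 *; move: e0; rewrite ltcR => e0.
have [N hN] := h _ e0; exists N => // n /= Nn; rewrite rnormE ltcR rnormBC; exact: hN.
Qed.

Lemma rnorm_cvg0P (u : nat -> H) x :
  (u @ \oo --> x) <-> ((fun n => rnorm (u n - x)) @ \oo --> (0 : R)).
Proof.
rewrite rnorm_cvgP; split=> [h|/cvgrPdist_lt h e e0].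
  apply/cvgrPdist_lt => e e0; have [N hN] := h _ e0; exists N => // n /= Nn.
  by rewrite sub0r normrN ger0_norm ?rnorm_ge0// hN.
have [N _ hN] := h _ e0; exists N => n Nn; have := hN n Nn.
by rewrite /= sub0r normrN ger0_norm ?rnorm_ge0.
Qed.

Lemma cvg_rnorm (u : nat -> H) x : u @ \oo --> x -> (fun n => rnorm (u n)) @ \oo --> rnorm x.
Proof.
move=> /rnorm_cvgP h; apply/cvgrPdist_lt => e e0; have [N hN] := h _ e0.
exists N => // n /= Nn; apply: le_lt_trans (hN n Nn).
rewrite ler_norml; have := rnormD (u n - x) x; have := rnormD (x - u n) (u n).
by rewrite !subrK (rnormBC x) => *; apply/andP; split; lra.
Qed.

Lemma cvg_rdot (u v : nat -> H) x y : u @ \oo --> x -> v @ \oo --> y ->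
  (fun n => rdot (u n) (v n)) @ \oo --> rdot x y.
Proof.
(* By polarization, convergence of inner products reduces to that of norms. *)
have pol a b : rdot a b = 4^-1 * (rnorm (a + b) ^+ 2 - rnorm (a - b) ^+ 2).
  by rewrite rnorm_sqrB rnorm_sqrD; field.
move=> ux vy; rewrite pol; under eq_fun do rewrite pol.
apply: cvgM; first exact: cvg_cst.
have sq (w : nat -> H) z : w @ \oo --> z ->
    (fun n => rnorm (w n) ^+ 2) @ \oo --> rnorm z ^+ 2.
  move=> wz; rewrite expr2; under eq_fun do rewrite expr2.
  by apply: cvgM; apply: cvg_rnorm.
by apply: cvgB; apply: sq; [apply: cvgD|apply: cvgB].
Qed.

Lemma cvg_bdd_linear (L : {linear H -> H}) (C : R) (u : nat -> H) x :
  (forall y, rnorm (L y) <= C * rnorm y) -> u @ \oo --> x -> (fun n => L (u n)) @ \oo --> L x.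
Proof.
move=> LC /rnorm_cvg0P ux; apply/rnorm_cvg0P.
apply: (@squeeze_cvgr _ _ _ _ (fun=> 0) (fun n => C * rnorm (u n - x))).
- by near=> n; rewrite rnorm_ge0/= -linearB LC.
- exact: cvg_cst.
- rewrite -[X in _ --> X](mulr0 C); apply: cvgM => //; exact: cvg_cst.
Unshelve. all: by end_near. Qed.

(** The indices [phi n] need not increase: [n <= phi n] is enough for [u \o phi]
    to inherit the limit of [u], and subsequences are used in this form below. *)
Lemma cvg_subseq (T : topologicalType) (u : nat -> T) (x : T) (phi : nat -> nat) :
  (forall n, (n <= phi n)%N) -> u @ \oo --> x -> (u \o phi) @ \oo --> x.
Proof.
move=> hphi ux A /ux [N _ hN]; exists N => // n /= Nn.
by apply: hN => /=; apply: leq_trans (hphi n).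
Qed.

Lemma rnorm_complete (u : nat -> H) :
  (forall e : R, 0 < e -> exists N, forall n m, (N <= n)%N -> (N <= m)%N ->
    rnorm (u n - u m) < e) ->
  exists x, u @ \oo --> x.
Proof.
move=> h; have : cvg (u @ \oo).
  apply/cauchy_cvgP/cauchy_ballP => e e0.
  have ee : e = (complex.Re e)%:C by rewrite RRe_real// gtr0_real.
  rewrite ee in e0 *; move: e0; rewrite ltcR => e0.
  have [N hN] := h _ e0.
  pose A := [set u n | n in [set n | (N <= n)%N]].
  exists (A, A) => /=.
    by split; exists N => // n /= Nn; exists n.
  move=> [_ _] /= [[n Nn <-] [m Nm <-]].
  by rewrite -ball_normE/= rnormE ltcR; exact: hN.
by move=> c; exists (lim (u @ \oo)).
Qed.

Lemma cvg_seq_le (u v : nat -> R) a b : u @ \oo --> a -> v @ \oo --> b ->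
  (forall n, u n <= v n) -> a <= b.
Proof. by move=> ua vb uv; apply: ler_cvg_to ua vb _; near=> n; exact: uv.
Unshelve. all: by end_near. Qed.

Lemma cvg_const (u : nat -> R) a b : u @ \oo --> a -> (forall n, u n = b) -> a = b.
Proof.
move=> ua ub; have vb : u @ \oo --> b.
  by have -> : u = fun=> b; [apply/funext|exact: cvg_cst].
exact: cvg_unique ua vb.
Qed.

Lemma invS_small (e : R) : 0 < e -> exists N, forall n, (N <= n)%N -> n.+1%:R^-1 < e.
Proof.
move=> e0; have /cvgrPdist_lt/(_ e e0)[N _ hN] := @cvg_harmonic R.
exists N => n Nn; have := hN n Nn.
by rewrite /= sub0r normrN ger0_norm// invr_ge0.
Qed.

Definition closure_pt (M : set H) x := forall e : R, 0 < e -> exists2 y, M y & rnorm (x - y) < e.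

Lemma closure_seq (M : set H) x : closure_pt M x ->
  exists2 u : nat -> H, forall n, M (u n) & u @ \oo --> x.
Proof.
move=> h; have /choice[u hu] : forall n : nat, exists y, M y /\ rnorm (y - x) < n.+1%:R^-1.
  move=> n; have [|y My xy] := h n.+1%:R^-1; first by rewrite invr_gt0 ltr0Sn.
  by exists y; rewrite rnormBC.
exists u => [n|]; first by case: (hu n).
apply/rnorm_cvgP => e /invS_small[N hN]; exists N => n /hN.
by apply: lt_trans; case: (hu n).
Qed.

Lemma dense_closure_pt (M : set H) x : dense M -> closure_pt M x.
Proof.
move=> dM e e0; have [||y [/= xy My]] := dM (ball x e%:C).
  - by exists x; apply: ballxx; rewrite ltcR.
  - exact: ball_open.
by exists y => //; move: xy; rewrite -ball_normE /= rnormE ltcR.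
Qed.

End RealPart.

(** * Orthogonal projection onto a closed subspace *)

Section Projection.
Context {R : realType} {H : completeNormedModType R[i]}.
Variable dot : {dot H for Num.conj}.
Hypothesis hdot : induces_norm dot.
Implicit Types (x y z : H) (M : set H).

Definition subspace M := M 0 /\ forall (a : R[i]) x y, M x -> M y -> M (a *: x + y).

Definition seq_closed M := forall x, closure_pt M x -> M x.

Lemma subspaceZ M a x : subspace M -> M x -> M (a *: x).
Proof. by move=> [M0 ML] Mx; rewrite -[_ *: _]addr0; apply: ML. Qed.

Lemma subspaceD M x y : subspace M -> M x -> M y -> M (x + y).
Proof. by move=> [M0 ML] Mx My; rewrite -[x]scale1r; apply: ML. Qed.

Lemma subspaceB M x y : subspace M -> M x -> M y -> M (x - y).
Proof. by move=> SM Mx My; apply: subspaceD => //; rewrite -scaleN1r; apply: subspaceZ. Qed.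

Lemma seq_closed_cvg M (u : nat -> H) x : seq_closed M -> (forall n, M (u n)) ->
  u @ \oo --> x -> M x.
Proof.
move=> cM Mu /rnorm_cvgP ux; apply: cM => e /ux[N hN].
by exists (u N) => //; rewrite rnormBC; apply: hN.
Qed.

Lemma seq_closedP M : (forall (u : nat -> H) x, (forall n, M (u n)) -> u @ \oo --> x -> M x) ->
  seq_closed M.
Proof. by move=> h x /closure_seq[u]; apply: h. Qed.

Lemma orth_subspace M x : subspace M -> (forall y, M y -> rdot dot x y = 0) ->
  forall y, M y -> dot x y = 0.
Proof. by move=> SM h y My; apply: dot0P; apply: h => //; apply: subspaceZ. Qed.

Lemma half_double x : (2^-1 : R)%:C *: (x + x) = x.
Proof.
rewrite -{1 2}[x]scale1r -scalerDl scalerA -(rmorph1 (real_complex R)) -rmorphD -rmorphM.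
have -> : 2^-1 * (1 + 1) = 1 :> R by field.
by rewrite rmorph1 scale1r.
Qed.

(** Nearest points exist: a minimizing sequence is Cauchy by the parallelogram
    identity, and first-order optimality of the limit [m] along each direction
    of [M] says that [x - m] is orthogonal to [M]. *)
Lemma proj_exists M x : subspace M -> seq_closed M ->
  exists m, M m /\ forall y, M y -> dot (x - m) y = 0.
Proof.
move=> SM cM; pose D := [set rnorm (x - m) ^+ 2 | m in M].
have D0 : D !=set0 by exists (rnorm (x - 0) ^+ 2), 0 => //; case: SM.
have lD : has_lbound D by exists 0 => _ [m _ <-]; rewrite sqr_ge0.
have dle m : M m -> inf D <= rnorm (x - m) ^+ 2.
  by move=> Mm; apply: ge_inf => //; exists m.
have /choice[u hu] : forall n : nat, exists m, M m /\ rnorm (x - m) ^+ 2 < inf D + n.+1%:R^-1.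
  move=> n; have [|_ [m Mm <-] hm] := @inf_adherent _ D n.+1%:R^-1 _ (conj D0 lD).
    by rewrite invr_gt0 ltr0Sn.
  by exists m.
have [|m um] := @rnorm_complete R H u.
  move=> e e0; have [N hN] := invS_small (divr_gt0 (exprn_gt0 2 e0) (ltr0Sn R 3)).
  exists N => n k /hN nN /hN kN.
  have [Mn hn] := hu n; have [Mk hk] := hu k.
  rewrite -(ltr_pXn2r (_ : 0 < 2)%N) ?nnegrE ?rnorm_ge0 ?(ltW e0)//.
  (* The midpoint of [u n] and [u k] is in [M], hence no closer to [x] than
     the infimum; this bounds the distance of [u n] and [u k]. *)
  have /dle : M (((2^-1 : R)%:C) *: (u n + u k)) by apply: subspaceZ => //; apply: subspaceD.
  have -> : x - (2^-1 : R)%:C *: (u n + u k) = (2^-1 : R)%:C *: ((x - u n) + (x - u k)).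
    by rewrite addrACA -opprD scalerBr half_double.
  have -> : u n - u k = (x - u k) - (x - u n) by rewrite opprB [RHS]addrC addrA subrK.
  rewrite rnormZr (rnorm_sqrB hdot (x - u k)) exprMn (rnorm_sqrD hdot (x - u n)).
  rewrite (rdotC _ (x - u k)) ger0_norm ?invr_ge0//.
  have -> : (2^-1 : R) ^+ 2 = 4^-1 by field.
  move: (_.+1%:R^-1) (_.+1%:R^-1) nN kN hn hk => p q; lra.
have Mm : M m by apply: seq_closed_cvg um => // n; case: (hu n).
have md : rnorm (x - m) ^+ 2 <= inf D.
  have c1 : (fun n => rnorm (x - u n) ^+ 2) @ \oo --> rnorm (x - m) ^+ 2.
    rewrite expr2; under eq_fun do rewrite expr2.
    by apply: cvgM; apply: cvg_rnorm; apply: cvgB => //; exact: cvg_cst.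
  apply: (cvg_seq_le c1 (_ : (fun n => inf D + n.+1%:R^-1) @ \oo --> inf D)).
    by rewrite -[X in _ --> X]addr0; apply: cvgD; [exact: cvg_cst|exact: cvg_harmonic].
  by move=> n; case: (hu n) => _ /ltW.
exists m; split=> //; apply: orth_subspace => // y My.
set r := rdot _ _ _.
have [y0|y0] := eqVneq y 0; first by rewrite /r y0 rdotC rdot_eq0// linear0l.
have y2 : 0 < rnorm y ^+ 2 by rewrite exprn_gt0// rnorm_gt0.
(* [r / |y|^2] is the step along [y] that decreases the distance most. *)
have /dle : M (m + (r / rnorm y ^+ 2)%:C *: y) by apply: subspaceD => //; apply: subspaceZ.
rewrite opprD addrA (rnorm_sqrB hdot) (rdotZr dot) -/r rnormZr exprMn real_normK ?num_real//.
move=> h; have : r ^+ 2 / rnorm y ^+ 2 <= 0.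
  have -> : r ^+ 2 / rnorm y ^+ 2 =
      2 * ((r / rnorm y ^+ 2) * r) - (r / rnorm y ^+ 2) ^+ 2 * rnorm y ^+ 2.
    by field; rewrite rnorm_eq0.
  move: h md; lra.
rewrite pmulr_lle0 ?invr_gt0// => h2; apply/eqP.
by rewrite -sqrf_eq0 eq_le h2 sqr_ge0.
Qed.

Definition is_proj M (P : H -> H) := forall x, M (P x) /\ forall y, M y -> dot (x - P x) y = 0.

Lemma proj_uniq M x m m' : subspace M -> M m -> M m' ->
  (forall y, M y -> dot (x - m) y = 0) -> (forall y, M y -> dot (x - m') y = 0) -> m = m'.
Proof.
move=> SM Mm Mm' h h'; apply/eqP; rewrite -subr_eq0; apply/eqP.
have Md : M (m - m') by apply: subspaceB.
have : dot (m - m') (m - m') = 0.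
  have -> : dot (m - m') (m - m') = dot (x - m') (m - m') - dot (x - m) (m - m').
    by rewrite -linearBl/=; congr (dot _ _); rewrite opprB [RHS]addrC addrA subrK.
  by rewrite h// h'// subr0.
by move/eqP; rewrite -hdot sqrf_eq0 normr_eq0 => /eqP.
Qed.

Lemma projector M : subspace M -> seq_closed M -> exists P : {linear H -> H}, is_proj M P.
Proof.
move=> SM cM; have /choice[P hP] := fun x => @proj_exists M x SM cM.
have Plin : linear P.
  move=> a x y; have [M1 h1] := hP (a *: x + y); have [M2 h2] := hP x; have [M3 h3] := hP y.
  apply: (@proj_uniq M (a *: x + y)) => //; first by case: SM => _; apply.
  move=> z Mz; rewrite opprD addrACA -scalerBr linearDl linearZl_LR/=.
  by rewrite h2// h3// mulr0 addr0.
by exists (HB.pack_for {linear H -> H} P (GRing.isLinear.Build _ _ _ _ P Plin)).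
Qed.

Section ProjTheory.
Variables (M : set H) (P : {linear H -> H}).
Hypotheses (SM : subspace M) (hP : is_proj M P).

Lemma proj_in x : M (P x). Proof. by case: (hP x). Qed.

Lemma proj_orth x y : M y -> dot (x - P x) y = 0.
Proof. by case: (hP x) => _; apply. Qed.

Lemma proj_id x : M x -> P x = x.
Proof.
move=> Mx; apply: (@proj_uniq M x) => //; [exact: proj_in|exact: proj_orth|].
by move=> y _; rewrite subrr linear0l.
Qed.

Lemma projK x : P (P x) = P x. Proof. by rewrite proj_id//; apply: proj_in. Qed.

Lemma proj_dotl x y : M y -> dot (P x) y = dot x y.
Proof. by move=> /(proj_orth x)/eqP; rewrite linearBl/= subr_eq0 => /eqP. Qed.

Lemma proj_dotr x y : M x -> dot x (P y) = dot x y.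
Proof. by move=> Mx; rewrite dotC proj_dotl// -dotC. Qed.

Lemma proj_sa x y : dot (P x) y = dot x (P y).
Proof. by rewrite -(proj_dotr _ (proj_in x)) proj_dotl//; exact: proj_in. Qed.

Lemma proj_eq0 x : P x = 0 <-> forall y, M y -> dot x y = 0.
Proof.
split=> [Px y My|h]; first by rewrite -proj_dotl// Px linear0l.
apply: (dot_nondeg hdot) => y; rewrite proj_sa; apply: h; exact: proj_in.
Qed.

Lemma proj_rnorm x : rnorm (P x) <= rnorm x.
Proof.
rewrite -(ler_pXn2r (_ : 0 < 2)%N) ?nnegrE ?rnorm_ge0//.
rewrite -[in leRHS](subrK (P x) x) (pythagoras hdot) ?lerDr ?sqr_ge0//.
by apply: proj_orth; exact: proj_in.
Qed.

End ProjTheory.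
End Projection.

(** * Compact positive operators *)

Section Compact.
Context {R : realType} {H : completeNormedModType R[i]}.
Variable dot : {dot H for Num.conj}.
Hypothesis hdot : induces_norm dot.
Implicit Types (x y z : H) (M : set H).

Definition compact_operator (K : H -> H) := forall u : nat -> H, (forall n, rnorm (u n) <= 1) ->
  exists (phi : nat -> nat) (y : H),
    (forall n, (n <= phi n)%N) /\ (fun n => K (u (phi n))) @ \oo --> y.

Record compact_positive (K : H -> H) : Prop := CompactPositive {
  cp_bounded : exists C, forall x, rnorm (K x) <= C * rnorm x;
  cp_selfadjoint : forall x y, dot (K x) y = dot x (K y);
  cp_ge0 : forall x, 0 <= rdot dot (K x) x;
  cp_compact : compact_operator K }.

Variable K : {linear H -> H}.
Hypothesis hK : compact_positive K.

Lemma rdot_selfadjoint x y : rdot dot (K x) y = rdot dot x (K y).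
Proof. by rewrite /rdot (cp_selfadjoint hK). Qed.

Lemma cvgK (u : nat -> H) x : u @ \oo --> x -> (fun n => K (u n)) @ \oo --> K x.
Proof. by have [C Kb] := cp_bounded hK; exact: cvg_bdd_linear Kb. Qed.

(** Approximate eigenvectors for [c != 0] accumulate at an eigenvector: along a
    subsequence [K (u n)] converges, hence so does [c u n], and [c] can be
    divided out.  The eigenvalues of [K] and the Fredholm alternative both come
    from this. *)
Lemma approx_eigen (c : R[i]) (u : nat -> H) : c != 0 -> (forall n, rnorm (u n) <= 1) ->
  (fun n => K (u n) - c *: u n) @ \oo --> (0 : H) ->
  exists (phi : nat -> nat) (x : H),
    [/\ forall n, (n <= phi n)%N, (u \o phi) @ \oo --> x & K x = c *: x].
Proof.
move=> c0 u1 u0; have [phi [y [hphi Ky]]] := cp_compact hK u1.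
have ux : (u \o phi) @ \oo --> c^-1 *: y.
  have -> : u \o phi = fun n => c^-1 *: (K (u (phi n)) - (K (u (phi n)) - c *: u (phi n))).
    by apply/funext => n /=; rewrite opprB [X in _ *: X]addrC subrK scalerA mulVf// scale1r.
  apply: cvgZr; rewrite -[X in _ --> X]subr0; apply: cvgB => //.
  exact: (cvg_subseq hphi u0).
exists phi, (c^-1 *: y); split=> //.
rewrite scalerA mulfV// scale1r.
exact: cvg_unique (cvgK ux) Ky.
Qed.

Lemma eigen_ge0 (c : R[i]) x : x != 0 -> K x = c *: x -> 0 <= c.
Proof.
move=> x0 Kx; have x2 : 0 < rnorm x ^+ 2 by rewrite exprn_gt0// rnorm_gt0.
have h : dot (K x) x = c * (rnorm x ^+ 2)%:C by rewrite Kx linearZl_LR/= (dotxx hdot).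
have -> : c = dot (K x) x / (rnorm x ^+ 2)%:C.
  by rewrite h mulfK// (inj_eq (@complexI R) _ 0) lt0r_neq0.
rewrite divr_ge0//; last by rewrite ler0c ltW.
have : complex.Im (dot (K x) x) == 0.
  have : dot (K x) x = (dot (K x) x)^*%C by rewrite {1}dotC -(cp_selfadjoint hK).
  by case: (dot (K x) x) => a b /(congr1 (@complex.Im _)) /= /eqP;
    rewrite -addr_eq0 -mulr2n mulrn_eq0.
by have := cp_ge0 hK x; rewrite /rdot; case: (dot (K x) x) => a b /= h2 /eqP ->; rewrite ler0c.
Qed.

Definition K_stable M := forall x, M x -> M (K x).

(** The supremum [k] of [(K x, x)] over the unit ball of an invariant closed
    subspace is an eigenvalue if it is positive, since a maximizing sequence is
    made of approximate eigenvectors.  If it is [0], the value [e = 0] records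
    that the form vanishes on [M]. *)
Lemma max_eigen M : subspace M -> seq_closed M -> K_stable M ->
  exists (k : R) (e : H), [/\ M e, K e = k%:C *: e, 0 <= k,
      (k = 0 -> e = 0) /\ (0 < k -> rnorm e = 1)
    & forall x, M x -> rdot dot (K x) x <= k * rnorm x ^+ 2].
Proof.
move=> SM cM KM.
pose Q := [set rdot dot (K x) x | x in [set x | M x /\ rnorm x <= 1]].
have [C Kb] := cp_bounded hK.
have Q0 : Q 0 by exists 0; rewrite /= ?rnorm0 ?linear0 ?rdot_eq0 ?linear0l//; split=> //; case: SM.
have ubQ : has_ubound Q.
  exists `|C| => _ [x [Mx x1] <-]; apply: le_trans (rdot_le hdot _ _) _.
  rewrite -[leRHS]mulr1; apply: ler_pM; rewrite ?rnorm_ge0//.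
  apply: le_trans (Kb x) _; rewrite -[leRHS]mulr1.
  apply: le_trans (_ : `|C| * rnorm x <= _); last by rewrite ler_wpM2l.
  by rewrite ler_wpM2r ?rnorm_ge0// ler_norm.
have hsQ : has_sup Q by split=> //; exists 0.
pose k := sup Q.
have k0 : 0 <= k by apply: ub_le_sup.
have kle x : M x -> rdot dot (K x) x <= k * rnorm x ^+ 2.
  move=> Mx; have [->|x0] := eqVneq x 0.
    by rewrite linear0 rdot_eq0 ?linear0l// rnorm0 expr0n mulr0.
  have xp : 0 < rnorm x by rewrite rnorm_gt0.
  rewrite -ler_pdivrMr ?exprn_gt0//.
  apply: ub_le_sup => //; exists ((rnorm x)^-1%:C *: x); last first.
    rewrite linearZ/= (rdotZl dot) (rdotZr dot); field; exact: lt0r_neq0.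
  split; first exact: subspaceZ.
  by rewrite rnormZr gtr0_norm ?invr_gt0// mulVf// lt0r_neq0.
move: (k0); rewrite le_eqVlt => /orP[/eqP k00|kp].
  exists 0, 0; split=> //; first by case: SM.
  - by rewrite linear0 scaler0.
  - by split=> //; rewrite ltxx.
  - by rewrite k00.
have /choice[u hu] : forall n : nat, exists x,
    [/\ M x, rnorm x <= 1 & k - n.+1%:R^-1 < rdot dot (K x) x].
  move=> n; have [|_ [x [Mx x1] <-] hx] := @sup_adherent _ Q n.+1%:R^-1 _ hsQ.
    by rewrite invr_gt0 ltr0Sn.
  by exists x.
have kC : k%:C != 0 :> R[i] by rewrite (inj_eq (@complexI R) _ 0) lt0r_neq0.
have [|phi [e [hphi ue Ke]]] := @approx_eigen k%:C u kC (fun n => let: And3 _ h _ := hu n in h).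
  (* With [A := k - K], a nonnegative form on [M] bounded by [k], the estimate
     is [|A x|^2 <= k (A x, x)]; it comes from [0 <= (A y, y)] at
     [y = x - k^-1 A x]. *)
  have est x : M x -> rnorm (K x - k%:C *: x) ^+ 2 <= k * (k * rnorm x ^+ 2 - rdot dot (K x) x).
    move=> Mx; pose A y := k%:C *: y - K y; have [a aE] : {a | a = A x} by exists (A x).
    rewrite rnormBC -/(A x) -aE.
    have Asa y z : rdot dot (A y) z = rdot dot y (A z).
      by rewrite /A rdotBl rdotBr (rdotZl dot) (rdotZr dot) rdot_selfadjoint.
    have Ap y : M y -> 0 <= rdot dot (A y) y.
      by move=> My; rewrite rdotBl (rdotZl dot) (rdotxx hdot) subr_ge0 kle.
    have Ma : M a by rewrite aE; apply: subspaceB; [|apply: subspaceZ|apply: KM].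
    have -> : k * rnorm x ^+ 2 - rdot dot (K x) x = rdot dot a x.
      by rewrite aE rdotBl (rdotZl dot) (rdotxx hdot).
    have : 0 <= rdot dot (A (x - k^-1%:C *: a)) (x - k^-1%:C *: a).
      by apply: Ap; apply: subspaceB => //; apply: subspaceZ.
    have -> : A (x - k^-1%:C *: a) = a - k^-1%:C *: A a.
      rewrite {1}/A (linearB K) (linearZ_LR K) !scalerBr opprD opprK addrACA aE;
        congr (_ + _) => //.
      by rewrite opprB addrC !scalerA mulrC.
    have Aaa : rdot dot (A a) a <= k * rnorm a ^+ 2.
      by rewrite rdotBl (rdotZl dot) (rdotxx hdot) gerBl (cp_ge0 hK).
    rewrite rdotBl !rdotBr !(rdotZl dot) !(rdotZr dot) (Asa a x) -aE (rdotxx hdot) => h.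
    have h2 : k^-1 * (k^-1 * rdot dot (A a) a) <= k^-1 * rnorm a ^+ 2.
      by rewrite ler_pM2l ?invr_gt0// ler_pdivrMl.
    have : k^-1 * rnorm a ^+ 2 <= rdot dot a x by move: h h2; lra.
    by rewrite ler_pdivrMl.
  apply/rnorm_cvgP => d d0.
  have [N hN] := invS_small (divr_gt0 (exprn_gt0 2 d0) kp).
  exists N => n /hN nN; case: (hu n) => Mu u1 hun.
  rewrite subr0 -(ltr_pXn2r (_ : 0 < 2)%N) ?nnegrE ?rnorm_ge0 ?(ltW d0)//.
  apply: le_lt_trans (est _ Mu) _; rewrite mulrC -ltr_pdivlMr//.
  apply: le_lt_trans nN; rewrite lerBlDr -lerBlDl; apply: le_trans (ltW hun).
  by rewrite lerB// -[leRHS]mulr1 ler_pM2l// expr_le1 ?rnorm_ge0.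
have Me : M e.
  by apply: seq_closed_cvg ue => // n; case: (hu (phi n)).
have e1 : rnorm e <= 1.
  apply: (cvg_seq_le (cvg_rnorm ue) (cvg_cst (1 : R))).
  by move=> n /=; case: (hu (phi n)).
have ke : k <= k * rnorm e ^+ 2.
  have -> : k * rnorm e ^+ 2 = rdot dot (K e) e by rewrite Ke (rdotZl dot) (rdotxx hdot).
  apply: (cvg_seq_le (_ : (fun n => k - (phi n).+1%:R^-1) @ \oo --> k)
    (cvg_rdot hdot (cvgK ue) ue)).
    rewrite -[X in _ --> X]subr0; apply: cvgB; first exact: cvg_cst.
    exact: (cvg_subseq hphi (@cvg_harmonic R)).
  by move=> n /=; case: (hu (phi n)) => _ _ /ltW.
exists k, e; split=> //; split=> [k00|_]; first by rewrite k00 ltxx in kp.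
apply/eqP; rewrite eq_le e1/= -(ler_pXn2r (_ : 0 < 2)%N) ?nnegrE ?rnorm_ge0// expr1n.
by rewrite -(ler_pM2l kp) mulr1.
Qed.

End Compact.

(** * Fredholm alternative and spectral theorem *)

Section Fredholm.
Context {R : realType} {H : completeNormedModType R[i]}.
Variable dot : {dot H for Num.conj}.
Hypothesis hdot : induces_norm dot.
Implicit Types (x y z : H) (M : set H).

Lemma bdd_below_cvg (u v : nat -> H) (B : R) y :
  (forall n m, rnorm (u n - u m) <= B * rnorm (v n - v m)) -> v @ \oo --> y ->
  exists x, u @ \oo --> x.
Proof.
move=> uv /rnorm_cvgP vy; apply: rnorm_complete => e e0.
have B0 : 0 < `|B| + 1 by rewrite ltr_wpDl.
have [N hN] := vy _ (divr_gt0 (divr_gt0 e0 (ltr0Sn R 1)) B0).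
exists N => n m Nn Nm; apply: le_lt_trans (uv n m) _.
apply: (@le_lt_trans _ _ ((`|B| + 1) * rnorm (v n - v m))).
  by rewrite ler_wpM2r ?rnorm_ge0// ler_wpDr// ler_norm.
rewrite mulrC -ltr_pdivlMr//.
have -> : v n - v m = (v n - y) + (y - v m) by rewrite addrA subrK.
apply: le_lt_trans (rnormD _ _) _; rewrite (rnormBC y).
have := hN n Nn; have := hN m Nm; rewrite -!mulrA (mulrC 2^-1) !mulrA; lra.
Qed.

Definition orthc (A : set H) := [set x | forall v, A v -> dot x v = 0].

Lemma orthc_subspace A : subspace (orthc A).
Proof.
split=> [v _|a x y hx hy v Av]; first by rewrite linear0l.
by rewrite linearDl linearZl_LR/= hx// hy// mulr0 addr0.
Qed.

Lemma orthc_closed A : seq_closed (orthc A).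
Proof.
apply: seq_closedP => u x hu ux v Av.
have r0 w : (forall n, rdot dot (u n) w = 0) -> rdot dot x w = 0.
  by move=> h; apply: (cvg_const (cvg_rdot hdot ux (cvg_cst w))).
apply: dot0P; apply: r0 => n; apply: rdot_eq0; first exact: hu.
by rewrite linearZr_LR/= hu// mulr0.
Qed.

Variable K : {linear H -> H}.
Hypothesis hK : compact_positive dot K.

(** Otherwise unit vectors [u n] with [(K - c) (u n)] tending to [0] would have a
    limit that is a unit eigenvector. *)
Lemma bounded_below (c : R[i]) : c != 0 -> (forall x, K x = c *: x -> x = 0) ->
  exists B : R, forall x, rnorm x <= B * rnorm (K x - c *: x).
Proof.
move=> c0 hc; apply: contrapT => nB.
have /choice[u hu] : forall n : nat, exists x, rnorm x = 1 /\ rnorm (K x - c *: x) < n.+1%:R^-1.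
  move=> n; apply: contrapT => h; apply: nB; exists n.+1%:R => x.
  have [->|x0] := eqVneq x 0; first by rewrite rnorm0 mulr_ge0// rnorm_ge0.
  have xp : 0 < rnorm x by rewrite rnorm_gt0.
  rewrite leNgt; apply/negP => hx; apply: h; exists ((rnorm x)^-1%:C *: x).
  rewrite rnormZr gtr0_norm ?invr_gt0// mulVf ?lt0r_neq0//; split=> //.
  rewrite (linearZ_LR K)/= scalerA mulrC -scalerA -scalerBr rnormZr gtr0_norm ?invr_gt0//.
  by rewrite ltr_pdivrMl// -(ltr_pM2l (ltr0Sn R n)) mulrCA mulfV ?pnatr_eq0// mulr1.
have [||phi [x [hphi ux Kx]]] := approx_eigen hK c0 (u := u).
- by move=> n; case: (hu n) => ->.
- apply/rnorm_cvgP => e e0; have [N hN] := invS_small e0.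
  exists N => n /hN; rewrite subr0; apply: lt_trans; by case: (hu n).
have : rnorm x = 1.
  by apply: (cvg_const (cvg_rnorm ux)) => n; case: (hu (phi n)).
by rewrite (hc _ Kx) rnorm0 => /eqP; rewrite eq_sym oner_eq0.
Qed.

(** The range of [K - c] is closed because [K - c] is bounded below, and a vector
    orthogonal to it is in the kernel of [K - conj c].  The eigenvalues of [K]
    are real, so that this kernel vanishes too. *)
Lemma fredholm (c : R[i]) : c != 0 -> (forall x, K x = c *: x -> x = 0) ->
  (exists B : R, forall x, rnorm x <= B * rnorm (K x - c *: x)) /\
  forall y, exists x, K x - c *: x = y.
Proof.
move=> c0 hc; have [B hB] := bounded_below c0 hc; split; first by exists B.
pose M := [set K x - c *: x | x in [set: H]].
have SM : subspace M.
  split; first by exists 0 => //; rewrite linear0 scaler0 subr0.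
  move=> a _ _ [x _ <-] [y _ <-]; exists (a *: x + y) => //.
  by rewrite linearP scalerDr opprD addrACA scalerBr !scalerA mulrC.
have cM : seq_closed M.
  apply: seq_closedP => v y hv vy.
  have /choice[u hu] : forall n, exists x, K x - c *: x = v n.
    by move=> n; case: (hv n) => x _ <-; exists x.
  have [|x ux] := @bdd_below_cvg u v B y _ vy.
    by move=> n m; rewrite -!hu opprD addrACA -linearB -opprD -scalerBr hB.
  exists x => //.
  have vx : v @ \oo --> K x - c *: x.
    have -> : v = fun n => K (u n) - c *: u n by apply/funext => n; rewrite hu.
    by apply: cvgB; [exact: (cvgK hK)|exact: cvgZr].
  exact: cvg_unique vx vy.
have [P hP] := projector hdot SM cM => y.
suff y0 : y - P y = 0.
  by have [[x _ hx] _] := hP y; exists x; rewrite hx; apply/eqP; rewrite eq_sym -subr_eq0 y0.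
set z := y - P y.
have Kz : K z = c^*%C *: z.
  apply/eqP; rewrite -subr_eq0; apply/eqP; apply: (dot_nondeg hdot) => x.
  have := proj_orth hP y (_ : M (K x - c *: x)); rewrite -/z => <-; last by exists x.
  by rewrite dotBl dotBr dotZl dotZr (cp_selfadjoint hK).
have [//|z0] := eqVneq z 0.
have cge := eigen_ge0 hdot hK z0 Kz.
apply: hc; rewrite Kz; congr (_ *: _).
by rewrite conj_ge0 in cge; move: cge; rewrite lecE; case: (c) => a b /= /andP[/eqP -> _];
  rewrite oppr0.
Qed.

(** The orthogonal complement of such a list is invariant under [K]. *)
Definition eigen_list (s : seq H) := forall v, v \in s -> exists c : R, K v = c%:C *: v.

Definition next_spec (s : seq H) (p : R * H) :=
  [/\ forall v, v \in s -> dot p.2 v = 0, K p.2 = p.1%:C *: p.2, 0 <= p.1,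
   (p.1 = 0 -> p.2 = 0) /\ (0 < p.1 -> rnorm p.2 = 1)
   & forall x, (forall v, v \in s -> dot x v = 0) -> rdot dot (K x) x <= p.1 * rnorm x ^+ 2].

Lemma next_exists s : eigen_list s -> exists p, next_spec s p.
Proof.
move=> es; have [||k [e [h1 h2 h3 h4 h5]]] := max_eigen hdot hK (orthc_subspace [set` s]).
- exact: orthc_closed.
- move=> x hx v vs; have [c Kv] := es v vs.
  by rewrite (cp_selfadjoint hK) Kv linearZr_LR/= hx// mulr0.
- by exists (k, e).
Qed.

(** Eigenvalues of [K] with eigenvectors, each maximal for the form on the
    orthogonal complement of the previous ones.  The list is infinite; when the
    positive eigenvalues are exhausted it goes on with [kap n = 0], [e n = 0]. *)
Record eigensystem (kap : nat -> R) (e : nat -> H) : Prop := Eigensystem {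
  es_eigen : forall n, K (e n) = (kap n)%:C *: e n;
  es_ge0 : forall n, 0 <= kap n;
  es_norm : forall n, (kap n = 0 -> e n = 0) /\ (0 < kap n -> rnorm (e n) = 1);
  es_orth : forall m n, (m < n)%N -> dot (e n) (e m) = 0;
  es_max : forall n x, (forall m, (m < n)%N -> dot x (e m) = 0) ->
    rdot dot (K x) x <= kap n * rnorm x ^+ 2 }.

Lemma spectral_sequence : exists (kap : nat -> R) (e : nat -> H), eigensystem kap e.
Proof.
have /choice[next hnext] : forall s, exists p, eigen_list s -> next_spec s p.
  move=> s; have [/next_exists[p hp]|h] := pselect (eigen_list s); first by exists p.
  by exists (0, 0).
have [es [es0 esS]] : exists es : nat -> seq H, es 0%N = [::] /\
    forall n, es n.+1 = rcons (es n) (next (es n)).2.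
  by exists (fix es n := if n is m.+1 then rcons (es m) (next (es m)).2 else [::]).
have mem n v : v \in es n <-> exists2 m, (m < n)%N & v = (next (es m)).2.
  elim: n => [|n IH]; first by rewrite es0; split=> // -[].
  rewrite esS mem_rcons in_cons; split=> [/orP[/eqP ->|/IH[m mn ->]]|[m]].
  - by exists n.
  - by exists m => //; exact: ltnW.
  - rewrite ltnS leq_eqVlt => /orP[/eqP -> ->|mn vE]; first by rewrite eqxx.
    by apply/orP; right; apply/IH; exists m.
have hes n : eigen_list (es n).
  elim: n => [|n IH] v; rewrite ?es0// esS mem_rcons in_cons => /orP[/eqP ->|vn];
    last exact: IH.
  by have [_ h _ _ _] := hnext _ IH; exists (next (es n)).1.
exists (fun n => (next (es n)).1), (fun n => (next (es n)).2).
split=> [n|n|n|m n mn|n x hx].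
- by case: (hnext _ (hes n)).
- by case: (hnext _ (hes n)).
- by case: (hnext _ (hes n)).
- by case: (hnext _ (hes n)) => h _ _ _ _; apply: h; apply/mem; exists m.
- case: (hnext _ (hes n)) => _ _ _ _; apply => v /mem[m mn ->]; exact: hx.
Qed.

End Fredholm.

(** * Finite-dimensional subspaces *)

Section LinearAlgebra.
Context {F : fieldType} {V : lmodType F}.

Lemma left_kernel m n (A : 'M[F]_(m, n)) : (n < m)%N -> exists2 c : 'rV[F]_m, c != 0 & c *m A = 0.
Proof.
move=> nm; apply: contrapT => h.
have : row_free A.
  apply: inj_row_free => c cA; apply/eqP/negPn/negP => c0; apply: h; by exists c.
by rewrite /row_free => /eqP rA; have := rank_leq_col A; rewrite rA leqNgt nm.
Qed.

Lemma sum_mulmx m n (A : 'M[F]_(m, n)) (c : 'rV[F]_m) (w : 'I_n -> V) :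
  \sum_(i < m) c 0 i *: (\sum_(j < n) A i j *: w j) = \sum_(j < n) (c *m A) 0 j *: w j.
Proof.
under eq_bigr do rewrite scaler_sumr.
rewrite exchange_big; apply: eq_bigr => j _; rewrite mxE scaler_suml.
by apply: eq_bigr => i _; rewrite scalerA.
Qed.

Lemma lin_indep_row m (v : 'I_m -> V) (c : 'rV[F]_m) : lin_indep v ->
  \sum_(i < m) c 0 i *: v i = 0 -> c = 0.
Proof. by move=> iv /(iv (fun i => c 0 i)) h; apply/rowP => i; rewrite h mxE. Qed.

Lemma lin_indep_leq m n (v : 'I_m -> V) (w : 'I_n -> V) : lin_indep v ->
  (forall i, lin_span w (v i)) -> (m <= n)%N.
Proof.
move=> iv vw; rewrite leqNgt; apply/negP => nm.
have [A hA] : exists A : 'M[F]_(m, n), forall i, v i = \sum_(j < n) A i j *: w j.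
  have [a ha] := choice vw; exists (\matrix_(i, j) a i j) => i.
  by rewrite [LHS]ha; apply: eq_bigr => j _; rewrite mxE.
have [c c0 cA] := left_kernel A nm.
move/eqP: c0; apply; apply: (lin_indep_row iv).
under eq_bigr do rewrite hA.
by rewrite sum_mulmx cA big1// => j _; rewrite mxE scale0r.
Qed.

End LinearAlgebra.

Section FiniteDim.
Context {R : realType} {H : completeNormedModType R[i]}.
Variable dot : {dot H for Num.conj}.
Hypothesis hdot : induces_norm dot.
Implicit Types (x y z : H) (M : set H).

(** The Gram matrix of [v] is invertible, and the conjugate of its inverse gives
    the coefficients of the dual family in terms of [v].  Its interest is that
    the coordinates on [v] become continuous functionals ([dual_expand]). *)
Lemma dual_family n (v : 'I_n -> H) : lin_indep v ->
  exists w : 'I_n -> H, forall i k, dot (v i) (w k) = (i == k)%:R.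
Proof.
move=> iv; pose G : 'M[R[i]]_n := \matrix_(i, k) dot (v i) (v k).
have Gu : G \in unitmx.
  rewrite -row_free_unit; apply: inj_row_free => c cG.
  apply: (lin_indep_row iv); set x := \sum_(i < n) _.
  have xv k : dot x (v k) = 0.
    have := congr1 (fun A : 'rV[R[i]]_n => A 0 k) cG; rewrite !mxE => <-.
    rewrite dot_suml; apply: eq_bigr => i _; by rewrite dotZl !mxE.
  apply: (dot_nondeg hdot) => y.
  suff: rnorm x = 0 by move/eqP; rewrite rnorm_eq0 => /eqP ->; exact: linear0l.
  have : dot x x = 0.
    apply: dotC0; rewrite {1}/x dot_suml big1// => i _.
    by rewrite dotZl (dotC0 (xv i)) mulr0.
  by rewrite (dotxx hdot) => /complexI/eqP; rewrite sqrf_eq0 => /eqP.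
exists (fun k => \sum_(l < n) (invmx G l k)^*%C *: v l) => i k.
have := congr1 (fun A : 'M[R[i]]_n => A i k) (mulmxV Gu); rewrite !mxE => <-.
rewrite dotC dot_suml rmorph_sum; apply: eq_bigr => l _.
by rewrite dotZl rmorphM/= conjcK -dotC mxE mulrC.
Qed.

Lemma finite_rank n (v w : 'I_n -> H) : exists (L : {linear H -> H}) (C : R),
  (forall x, L x = \sum_(i < n) dot x (w i) *: v i) /\ forall x, rnorm (L x) <= C * rnorm x.
Proof.
pose L x := \sum_(i < n) dot x (w i) *: v i.
have Llin : linear L.
  move=> a x y; rewrite /L scaler_sumr -big_split; apply: eq_bigr => i _.
  by rewrite dotDl dotZl scalerDl scalerA.
exists (HB.pack_for {linear H -> H} L (GRing.isLinear.Build _ _ _ _ L Llin)).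
exists (\sum_(i < n) rnorm (w i) * rnorm (v i)); split=> // x /=.
rewrite /L mulr_suml.
elim/big_rec2: _ => [|i a y _ h]; first by rewrite rnorm0.
apply: le_trans (rnormD _ _) _; rewrite lerD// rnormZ mulrAC ler_wpM2r ?rnorm_ge0//.
by rewrite mulrC dot_le.
Qed.

Lemma dual_expand n (v w : 'I_n -> H) x : (forall i k, dot (v i) (w k) = (i == k)%:R) ->
  lin_span v x -> x = \sum_(i < n) dot x (w i) *: v i.
Proof.
move=> vw [c ->]; apply: eq_bigr => i _; congr (_ *: _).
rewrite dot_suml (bigD1 i)//= dotZl vw eqxx mulr1 big1 ?addr0// => k /negPf ki.
by rewrite dotZl vw ki mulr0.
Qed.

Lemma lin_span_subspace n (v : 'I_n -> H) : subspace (lin_span v).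
Proof.
split; first by exists (fun=> 0); rewrite big1// => i _; rewrite scale0r.
move=> a x y [c ->] [d ->]; exists (fun i => a * c i + d i).
rewrite scaler_sumr -big_split; apply: eq_bigr => i _.
by rewrite scalerA scalerDl.
Qed.

Lemma lin_span_mem n (v : 'I_n -> H) i : lin_span v (v i).
Proof.
exists (fun k => (k == i)%:R); rewrite (bigD1 i)//= eqxx scale1r big1 ?addr0// => k /negPf ->.
by rewrite scale0r.
Qed.

(** A finite-dimensional subspace is the fixed-point set of a bounded operator,
    built on the dual family. *)
Lemma lin_span_closed n (v : 'I_n -> H) : lin_indep v -> seq_closed (lin_span v).
Proof.
move=> /dual_family[w vw]; have [L [C [LE LC]]] := finite_rank v w.
apply: seq_closedP => u x hu ux; exists (fun i => dot x (w i)); rewrite -LE.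
have c : u @ \oo --> L x.
  have -> : u = fun n => L (u n) by apply/funext => k; rewrite LE; apply: dual_expand.
  exact: cvg_bdd_linear ux.
exact: cvg_unique ux c.
Qed.

End FiniteDim.

(** * The compressed inverse of [S] and the graph of the Krein extension *)

Section KreinOperator.
Context {R : realType} {H : completeNormedModType R[i]}.
Variable dot : {dot H for Num.conj}.
Hypothesis hdot : induces_norm dot.
Implicit Types (x y z f g : H) (M : set H).

Lemma precompact_subseq M (u : nat -> H) : precompact M -> (forall n, M (u n)) ->
  exists (phi : nat -> nat) (y : H), (forall n, (n <= phi n)%N) /\ (u \o phi) @ \oo --> y.
Proof.
rewrite precompactE => cM uM.
have [|y [_ yc]] := cM (u @ \oo) _.
  by exists 0%N => // n _; apply: subset_closure.
have /choice[phi hphi] : forall n, exists m, (n <= m)%N /\ rnorm (u m - y) < n.+1%:R^-1.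
  move=> n.
  have [||z [[m nm <-] yz]] :=
    yc [set u m | m in [set m | (n <= m)%N]] (ball y (n.+1%:R^-1 : R)%:C).
  - by exists n => // m nm; exists m.
  - by apply: nbhsx_ballx; rewrite ltcR invr_gt0 ltr0Sn.
  by exists m; split=> //; move: yz; rewrite -ball_normE /= rnormE ltcR rnormBC.
exists phi, y; split=> [n|]; first by case: (hphi n).
apply/rnorm_cvgP => e e0; have [N hN] := invS_small e0.
by exists N => n /hN; apply: lt_trans; case: (hphi n).
Qed.

Variable S : operator H.
Hypothesis hlin : linear_operator S.
Hypothesis hclosed : closed_operator S.
Hypothesis hsym : symmetric_operator dot S.
Hypothesis hdense : densely_defined S.
Variable mu : R.
Hypothesis mu0 : 0 < mu.
Hypothesis hlow : forall f, op_dom S f -> mu * rnorm f ^+ 2 <= rdot dot (S f) f.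
Hypothesis hcompact : compact_embedding S.
Local Notation D := (op_dom S).
Local Notation ranS := [set S f | f in D].

Lemma dom_subspace : subspace D.
Proof. by case: hlin => D0 DL; split=> // a x y Dx Dy; case: (DL a x y Dx Dy). Qed.

Lemma op_linear a f g : D f -> D g -> S (a *: f + g) = a *: S f + S g.
Proof. by case: hlin => _ h Df Dg; case: (h a f g Df Dg). Qed.

Lemma op0 : S 0 = 0.
Proof.
have D0 := dom_subspace.1; have := op_linear 1 D0 D0.
by rewrite !scale1r addr0 => /eqP; rewrite -subr_eq0 opprD addNKr oppr_eq0 => /eqP.
Qed.

Lemma opZ a f : D f -> S (a *: f) = a *: S f.
Proof. by move=> Df; rewrite -[a *: f]addr0 op_linear ?op0 ?addr0//; case: dom_subspace. Qed.

Lemma opB f g : D f -> D g -> S (f - g) = S f - S g.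
Proof. by move=> Df Dg; rewrite addrC -scaleN1r op_linear// scaleN1r addrC. Qed.

Lemma op_sum n (c : 'I_n -> R[i]) (v : 'I_n -> H) : (forall i, D (v i)) ->
  D (\sum_(i < n) c i *: v i) /\ S (\sum_(i < n) c i *: v i) = \sum_(i < n) c i *: S (v i).
Proof.
move=> Dv; elim/big_rec2: _ => [|i a y _ [Dy <-]]; first by split; [case: dom_subspace|exact: op0].
by split; [apply: (dom_subspace).2|apply: op_linear].
Qed.

Lemma op_bdd_below f : D f -> rnorm f <= mu^-1 * rnorm (S f).
Proof.
move=> Df; have [->|f0] := eqVneq f 0.
  by rewrite rnorm0 mulr_ge0 ?invr_ge0 ?rnorm_ge0// ltW.
have fp : 0 < rnorm f by rewrite rnorm_gt0.
rewrite ler_pdivlMl// -(ler_pM2r fp) -mulrA -expr2.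
exact: le_trans (hlow Df) (rdot_le hdot _ _).
Qed.

Lemma op_inj f g : D f -> D g -> S f = S g -> f = g.
Proof.
move=> Df Dg fg; apply/eqP; rewrite -subr_eq0 -rnorm_eq0 eq_le rnorm_ge0 andbT.
have Dfg : D (f - g) by apply: subspaceB => //; exact: dom_subspace.
by apply: le_trans (op_bdd_below Dfg) _; rewrite opB// fg subrr rnorm0 mulr0.
Qed.

Lemma op_pos f : D f -> f != 0 -> 0 < rdot dot (S f) f.
Proof.
move=> Df f0; apply: lt_le_trans (hlow Df).
by rewrite mulr_gt0// exprn_gt0// rnorm_gt0.
Qed.

Lemma ran_subspace : subspace ranS.
Proof.
split; first by exists 0; [case: dom_subspace|exact: op0].
move=> a _ _ [f Df <-] [g Dg <-]; exists (a *: f + g); last exact: op_linear.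
exact: (dom_subspace).2.
Qed.

(** If [S (u n)] converges then [u n] is Cauchy, as [S] is bounded below; the
    limit is in [dom S] because the graph of [S] is closed. *)
Lemma ran_closed : seq_closed ranS.
Proof.
apply: seq_closedP => v y hv vy.
have /choice[u hu] : forall n, exists f, D f /\ S f = v n.
  by move=> n; case: (hv n) => f Df <-; exists f.
have [|f uf] := @bdd_below_cvg R H u v mu^-1 y _ vy.
  move=> n m; have [[Dn <-] [Dm <-]] := (hu n, hu m).
  by rewrite -opB//; apply: op_bdd_below; apply: subspaceB => //; exact: dom_subspace.
have [|Df yS] := hclosed (_ : closure _ (f, y)); last by exists f.
move=> B fyB; have [N _ hN] : \forall n \near \oo, B (u n, v n).
  exact: (cvg_pair uf vy fyB).
by exists (u N, v N); split; [case: (hu N) => /= Df ->|exact: hN (leqnn N)].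
Qed.

(** [K] is [P S^-1 P].  Composing with [P] on both sides makes it a selfadjoint
    operator on the whole space: [(K x, y) = (S^-1 P x, P y)], which is symmetric
    in [x] and [y] because [S] is. *)
Lemma compression : exists P K : {linear H -> H},
  [/\ is_proj dot ranS P,
      forall f, D f -> K (S f) = P f,
      forall x, P (K x) = K x
    & compact_positive dot K].
Proof.
have [P hP] := projector hdot ran_subspace ran_closed.
have /choice[G hG] : forall x, exists f, D f /\ S f = P x.
  by move=> x; case: (hP x) => -[f Df Sf] _; exists f.
have DG x : D (G x) by case: (hG x).
have SG x : S (G x) = P x by case: (hG x).
have Glin : linear G.
  move=> a x y; apply: op_inj => //; first exact: (dom_subspace).2.
  by rewrite op_linear// !SG linearP.
have GS f : D f -> G (S f) = f.
  move=> Df; apply: op_inj => //; rewrite SG (proj_id hdot ran_subspace hP)//.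
  by exists f.
have KPlin : linear (P \o G) by move=> a x y; rewrite /= Glin linearP.
have Gb x : rnorm (G x) <= mu^-1 * rnorm x.
  apply: le_trans (op_bdd_below (DG x)) _.
  by rewrite ler_pM2l ?invr_gt0// SG (proj_rnorm hdot hP).
have Kdot x y : dot (P (G x)) y = dot (S (G x)) (G y).
  rewrite (proj_sa hP) -SG -hsym//.
pose K := HB.pack_for {linear H -> H} (P \o G) (GRing.isLinear.Build _ _ _ _ _ KPlin).
have KE x : K x = P (G x) by [].
exists P, K; split=> //.
- by move=> f Df; rewrite KE GS.
- by move=> x; rewrite !KE (projK hdot ran_subspace hP).
split.
- exists mu^-1 => x; rewrite KE; exact: le_trans (proj_rnorm hdot hP _) (Gb x).
- by move=> x y; rewrite !KE Kdot SG (proj_sa hP).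
- move=> x; rewrite KE /rdot Kdot -/(rdot dot _ _).
  by apply: le_trans (hlow (DG x)); rewrite mulr_ge0 ?sqr_ge0// ltW.
- move=> u u1; have [|phi [f [hphi uf]]] := @precompact_subseq _ (G \o u) hcompact.
    move=> n /=; split=> //; rewrite rnormE -[1]/(1%:C) lecR SG.
    exact: le_trans (proj_rnorm hdot hP _) (u1 n).
  exists phi, (P f); split=> //.
  apply: (@cvg_bdd_linear _ _ P 1 (fun n => G (u (phi n)))) => // x.
  by rewrite mul1r (proj_rnorm hdot hP).
Qed.

Lemma adjoint_uniq g h : adjoint_at dot S g h -> adjoint dot S g = h.
Proof.
move=> gh; have gh' : adjoint_at dot S g (adjoint dot S g) by apply: xgetPex; exists h.
apply/eqP; rewrite -subr_eq0; apply/eqP; apply: (dot_nondeg hdot) => y.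
apply: dotC0.
have : orthc dot [set adjoint dot S g - h] y; last by apply.
apply: (orthc_closed hdot) => e e0.
have [z Dz yz] := dense_closure_pt y hdense e0.
by exists z => // _ ->; rewrite dotBr -gh// -gh'// subrr.
Qed.

Variables (P K : {linear H -> H}).
Hypothesis hP : is_proj dot ranS P.
Hypothesis KS : forall f, D f -> K (S f) = P f.

Lemma adjoint_kerP g : op_ker (adjoint dot S) g <-> P g = 0.
Proof.
rewrite (proj_eq0 hdot hP); split=> [[[h gh] g0] _ [f Df <-]|h].
  apply: dotC0; rewrite gh//; have := adjoint_uniq gh; rewrite g0 => <-.
  by apply: dotC0; exact: linear0l.
have g0 : adjoint_at dot S g 0.
  move=> f Df; rewrite [RHS](dotC0 (linear0l _ _)).
  by apply: dotC0; apply: h; exists f.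
by split; [exists 0|exact: adjoint_uniq].
Qed.

(** For [u = f + g] with [f] in [dom S] and [P g = 0], the value is [w = S f];
    then [P u = P f = K w].  Conversely [f = S^-1 w] is recovered from [w], and
    [P u = K w = P f] puts [u - f] in [ker S^*]. *)
Lemma krein_graph u w : (op_dom (krein_von_neumann dot S) u /\ krein_von_neumann dot S u = w) <->
  (P w = w /\ P u = K w).
Proof.
have key f g : D f -> op_ker (adjoint dot S) g -> krein_von_neumann dot S (f + g) = S f.
  move=> Df [[h gh] g0]; apply: adjoint_uniq => f' Df'.
  rewrite linearDr/= gh// -(adjoint_uniq gh) g0 hsym//.
  by rewrite (dotC0 (linear0l _ _)) addr0.
split=> [[[f Df [g kg <-]] <-]|[Pw Pu]].
  rewrite key//; split; first by apply: (proj_id hdot ran_subspace hP); exists f.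
  by rewrite linearD/= KS//; move/adjoint_kerP: kg => ->; rewrite addr0.
have [f Df Sf] : ranS w by rewrite -Pw; exact: proj_in.
have kg : op_ker (adjoint dot S) (u - f).
  by apply/adjoint_kerP; rewrite linearB/= Pu -Sf KS// subrr.
split; first by exists f => //; exists (u - f) => //; rewrite addrC subrK.
by rewrite -Sf -(key f (u - f))// [f + _]addrC subrK.
Qed.

End KreinOperator.

(** * Eigenspaces of a compact positive operator *)

Section EigenCount.
Context {R : realType} {H : completeNormedModType R[i]}.
Variable dot : {dot H for Num.conj}.
Hypothesis hdot : induces_norm dot.
Implicit Types (x y z f g : H) (M : set H).
Variables (K : {linear H -> H}) (kap : nat -> R) (e : nat -> H).
Hypothesis hK : compact_positive dot K.
Hypothesis hE : eigensystem dot K kap e.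
Local Notation Ksa := (cp_selfadjoint hK).
Local Notation Kc := (cp_compact hK).
Local Notation Ke := (es_eigen hE).
Local Notation kap_ge0 := (es_ge0 hE).
Local Notation e_norm := (es_norm hE).
Local Notation e_orth := (es_orth hE).
Local Notation kap_max := (es_max hE).

Lemma e_dot m n : m != n -> dot (e m) (e n) = 0.
Proof. by rewrite neq_ltn => /orP[mn|/e_orth//]; apply: dotC0; exact: e_orth. Qed.

Lemma e_dot1 n : 0 < kap n -> dot (e n) (e n) = 1.
Proof. by move=> /(e_norm n).2 h; rewrite (dotxx hdot) h expr1n. Qed.

Lemma kap_anti m n : (m <= n)%N -> kap n <= kap m.
Proof.
rewrite leq_eqVlt => /orP[/eqP -> //|mn].
have := kap_ge0 n; rewrite le_eqVlt => /orP[/eqP <-|kn]; first exact: kap_ge0.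
have := kap_max (n := m) (x := e n).
rewrite Ke (rdotZl dot) (rdotxx hdot) (e_norm n).2// expr1n !mulr1; apply => i im.
by apply: e_orth; exact: ltn_trans mn.
Qed.

(** Otherwise the vectors [K (e n)] would be pairwise at distance at least
    [sqrt 2 * eps], and no subsequence of them could converge. *)
Lemma kap_small (eps : R) : 0 < eps -> exists N, kap N < eps.
Proof.
move=> eps0; apply: contrapT => h.
have kge n : eps <= kap n by rewrite leNgt; apply/negP => kn; apply: h; exists n.
have kp n : 0 < kap n by apply: lt_le_trans (kge n).
have [|phi [y [hphi /rnorm_cvgP Ky]]] := Kc (u := e).
  by move=> n; rewrite (e_norm n).2.
have [N hN] := Ky _ (divr_gt0 eps0 (ltr0Sn R 1)).
pose a := phi N; pose b := phi (phi N).+1.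
have ab : (a < b)%N by apply: hphi.
have d : rnorm (K (e a) - K (e b)) < eps.
  have -> : K (e a) - K (e b) = (K (e a) - y) + (y - K (e b)) by rewrite addrA subrK.
  apply: le_lt_trans (rnormD _ _) _; rewrite (rnormBC y).
  have := hN N (leqnn N); have := hN (phi N).+1 (leq_trans (hphi N) (leqnSn _)).
  rewrite -/a -/b; lra.
have : rnorm (K (e a) - K (e b)) ^+ 2 < eps ^+ 2 by rewrite ltr_pXn2r// ?nnegrE ?rnorm_ge0// ltW.
rewrite !Ke (pythagorasB hdot) ?rnormZr; last first.
  by rewrite dotZl dotZr e_dot ?mulr0// neq_ltn ab.
rewrite !ger0_norm ?kap_ge0// !(e_norm _).2// !mulr1 ltNge => /negP; apply.
by apply: ler_wpDr; rewrite ?sqr_ge0// lerXn2r// nnegrE ?kap_ge0// ltW.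
Qed.

Lemma expansion_orth N x i : (i < N)%N -> dot (x - \sum_(j < N) dot x (e j) *: e j) (e i) = 0.
Proof.
move=> iN; rewrite dotBl dot_suml (bigD1 (Ordinal iN))//= big1 => [|j ji]; last first.
  by rewrite dotZl e_dot ?mulr0.
rewrite addr0 dotZl; have := kap_ge0 i; rewrite le_eqVlt => /orP[/eqP k0|/e_dot1 ->].
  by rewrite (e_norm i).1// ?(dotC0 (linear0l _ _)) ?mul0r ?subrr.
by rewrite mulr1 subrr.
Qed.

Lemma eigen_dot (k : R) x i : K x = k%:C *: x -> kap i != k -> dot x (e i) = 0.
Proof.
move=> Kx ki; have := Ksa x (e i); rewrite Kx Ke dotZl dotZr conjc_real => /eqP.
rewrite -subr_eq0 -mulrBl mulf_eq0 -rmorphB (inj_eq (@complexI R) _ 0) subr_eq0.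
by rewrite eq_sym (negPf ki) => /eqP.
Qed.

(** The remainder of the expansion is an eigenvector for [k] orthogonal to the
    first [N] vectors, where the form is at most [kap N |x|^2 < k |x|^2]. *)
Lemma eigen_expand (k : R) x N : K x = k%:C *: x -> kap N < k ->
  x = \sum_(i < N) dot x (e i) *: e i.
Proof.
move=> Kx kN; set s := \sum_(i < N) _.
have Ks : K s = k%:C *: s.
  rewrite linear_sum scaler_sumr; apply: eq_bigr => i _; rewrite linearZ/= Ke !scalerA mulrC.
  have [->//|ki] := eqVneq (kap i) k.
  by rewrite (eigen_dot Kx ki) !mulr0 !scale0r.
have Kd : K (x - s) = k%:C *: (x - s) by rewrite linearB/= Kx Ks scalerBr.
have := kap_max (fun i => @expansion_orth N x i); rewrite -/s Kd (rdotZl dot) (rdotxx hdot) => h.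
apply/eqP; rewrite -subr_eq0 -rnorm_eq0 -sqrf_eq0 eq_le sqr_ge0 andbT leNgt.
by apply/negP => d0; move: h; rewrite ler_pM2r// leNgt kN.
Qed.

Lemma e_indep n (f : 'I_n -> nat) : injective f -> (forall i, 0 < kap (f i)) ->
  lin_indep (fun i => e (f i)).
Proof.
move=> finj fk c h i.
have : dot (\sum_(i < n) c i *: e (f i)) (e (f i)) = 0 by rewrite h linear0l.
rewrite dot_suml (bigD1 i)//= dotZl e_dot1// mulr1 big1 ?addr0// => j ji.
by rewrite dotZl e_dot ?mulr0// (inj_eq finj).
Qed.

(** The sequence [kap] decreases to [0], so a positive value is taken on a finite
    interval of indices, empty if the value is not taken. *)
Lemma eigen_block (k : R) : 0 < k -> exists a b : nat,
  [/\ (a <= b)%N, forall i, (kap i = k) <-> (a <= i < b)%N & kap b < k].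
Proof.
move=> k0; have exb : exists n, kap n < k by exact: kap_small.
have exa : exists n, kap n <= k by have [n /ltW] := exb; exists n.
pose a := ex_minn exa; pose b := ex_minn exb.
have [ha hamin] : kap a <= k /\ forall n, kap n <= k -> (a <= n)%N by rewrite /a; case: ex_minnP.
have [hb hbmin] : kap b < k /\ forall n, kap n < k -> (b <= n)%N by rewrite /b; case: ex_minnP.
exists a, b; split=> //; first by apply: hamin; exact: ltW.
move=> i; split=> [ki|/andP[ai ib]].
  rewrite hamin ?ki//= ltnNge; apply/negP => bi.
  by have := kap_anti bi; rewrite ki leNgt hb.
apply/eqP; rewrite eq_le (le_trans (kap_anti ai))//= leNgt; apply/negP => /hbmin.
by rewrite leqNgt ib.
Qed.

Lemma eigenspace_span (k : R) (a b : nat) : 0 < k -> (a <= b)%N ->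
  (forall i, (kap i = k) <-> (a <= i < b)%N) -> kap b < k ->
  lin_indep (fun i : 'I_(b - a) => e (a + i)) /\
  [set x | K x = k%:C *: x] = lin_span (fun i : 'I_(b - a) => e (a + i)).
Proof.
move=> k0 ab hk kb.
have kabi (i : 'I_(b - a)) : kap (a + i) = k.
  by apply/hk; rewrite leq_addr/= -ltn_subRL.
split.
  apply: (@e_indep _ (fun i => a + i)%N); last by move=> i; rewrite kabi.
  by move=> i j /addnI/val_inj.
apply/seteqP; split=> x /= => [Kx|[c ->]]; last first.
  rewrite linear_sum scaler_sumr; apply: eq_bigr => i _; rewrite linearZ/= Ke kabi.
  by rewrite !scalerA mulrC.
exists (fun i => dot x (e (a + i))); rewrite {1}(eigen_expand Kx kb).
rewrite -(big_mkord predT (fun i => dot x (e i) *: e i)) (big_cat_nat _ (n := a))//=.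
rewrite big_nat_cond big1 ?add0r => [|i /andP[/andP[_ ia] _]]; last first.
  rewrite (eigen_dot Kx) ?scale0r//; apply/eqP => /hk/andP[ai _].
  by move: ai; rewrite leqNgt ia.
by rewrite -{1}[a]add0n big_addn big_mkord; apply: eq_bigr => i _; rewrite addnC.
Qed.

Lemma eigen_listed (k : R) x : 0 < k -> x != 0 -> K x = k%:C *: x -> exists i, kap i = k.
Proof.
move=> k0 x0 Kx; have [a [b [ab hk kb]]] := eigen_block k0.
have [ba|] := leqP b a; last by move=> lab; exists a; apply/hk; rewrite leqnn.
move: x0; have [_] := eigenspace_span k0 ab hk kb.
move/seteqP => [/(_ x Kx)[c ->] _]; rewrite big1 ?eqxx// => i _.
by have := leq_ltn_trans (leq0n i) (ltn_ord i); rewrite subn_gt0 ltnNge ba.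
Qed.

End EigenCount.

(** Points of a finite set other than [r] stay away from [r], which is what
    isolation in the spectrum reduces to. *)
Lemma finite_gap (R : realType) (s : seq R) (r : R) :
  exists2 d : R, 0 < d & forall x, x \in s -> x != r -> d <= `|x - r|.
Proof.
elim: s => [|y s [d d0 IH]]; first by exists 1.
have [yr|yr] := eqVneq y r.
  exists d => // x; rewrite in_cons => /orP[/eqP -> |]; last exact: IH.
  by rewrite yr eqxx.
exists (Order.min d `|y - r|); first by rewrite lt_min d0 normr_gt0 subr_eq0.
move=> x; rewrite in_cons ge_min => /orP[/eqP -> _|xs xr]; first by rewrite lexx orbT.
by rewrite IH.
Qed.

(** * Spectrum of the Krein extension *)

Section KreinSpectrum.
Context {R : realType} {H : completeNormedModType R[i]}.
Variable dot : {dot H for Num.conj}.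
Hypothesis hdot : induces_norm dot.
Implicit Types (x y z f g u w h : H) (M : set H).
Variables (P K : {linear H -> H}).
Hypothesis PP : forall x, P (P x) = P x.
Hypothesis Pb : forall x, rnorm (P x) <= rnorm x.
Hypothesis PK : forall x, P (K x) = K x.
Hypothesis hK : compact_positive dot K.
Variable T : operator H.
(* What [krein_graph] says of the Krein-von Neumann extension; the rest of the
   section depends on nothing else about [T]. *)
Hypothesis hT : forall u w, (op_dom T u /\ T u = w) <-> (P w = w /\ P u = K w).

Lemma krein_eigenspace (l : R[i]) : l != 0 -> op_eigenspace T l = [set u | K u = l^-1 *: u].
Proof.
move=> l0; apply/seteqP; split=> u /= => [/hT|Ku].
  rewrite !linearZ/= => -[/(congr1 (fun x => l^-1 *: x))].
  rewrite !scalerA mulVf// !scale1r => -> /(congr1 (fun x => l^-1 *: x)).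
  by rewrite scalerA mulVf// scale1r => <-.
have Pu : P u = u.
  have -> : u = l *: K u by rewrite Ku scalerA mulfV// scale1r.
  by rewrite linearZ/= PK.
by apply/hT; rewrite !linearZ/= Pu Ku scalerA mulfV// scale1r.
Qed.

Lemma resolvent_of (l : R[i]) (M : R) :
  (forall u, op_dom T u -> rnorm u <= M * rnorm (T u - l *: u)) ->
  (forall h, exists u, op_dom T u /\ T u - l *: u = h) -> resolvent_set T l.
Proof.
move=> hM hs; split.
  split=> // [u v|h _]; last by have [u [Du Tu]] := hs h; exists u.
  rewrite !inE => Du Dv uv.
  have [Pu1 Pu2] := (hT u _).1 (conj Du erefl); have [Pv1 Pv2] := (hT v _).1 (conj Dv erefl).
  have [Duv Tuv] : op_dom T (u - v) /\ T (u - v) = T u - T v.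
    by apply/hT; rewrite !linearB/= Pu1 Pv1 Pu2 Pv2.
  apply/eqP; rewrite -subr_eq0 -rnorm_eq0 eq_le rnorm_ge0 andbT.
  apply: le_trans (hM _ Duv) _.
  have -> : T (u - v) - l *: (u - v) = (T u - l *: u) - (T v - l *: v).
    by rewrite Tuv scalerBr !opprD !opprK addrACA.
  by rewrite uv subrr rnorm0 mulr0.
exists M%:C => u Du; rewrite !rnormE -rmorphM lecR; exact: hM.
Qed.

(** With [c = l^-1], the equation [T u - l u = h] is
    [(K - c) u = c (c (h - P h) - K h)]: apply [K], which gives
    [P u = K h + l K u], and [1 - P], which gives [(1 - P) u = - c (h - P h)]. *)
Lemma resolvent_nonzero (l : R[i]) : l != 0 -> (forall x, K x = l^-1 *: x -> x = 0) ->
  resolvent_set T l.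
Proof.
move=> l0 hl; set c := l^-1 in hl *.
have c0 : c != 0 by rewrite invr_eq0.
have lc : l * c = 1 by rewrite mulfV.
have cl : c * l = 1 by rewrite mulVf.
have [C Kb] := cp_bounded hK.
have [[B hB] hsurj] := fredholm hdot hK c0 hl.
pose q := complex.Re `|c|.
have q0 : 0 <= q by rewrite -ler0c RRe_real.
apply: (@resolvent_of l (`|B| * (q * (q * 2 + `|C|)))).
  move=> u Du; have [h hE] : {h | h = T u - l *: u} by exists (T u - l *: u).
  rewrite -hE.
  have [Pw Pu] := (hT u _).1 (conj Du erefl).
  have Tu : T u = h + l *: u by rewrite hE subrK.
  have Ku : K u - c *: u = c *: (c *: (h - P h) - K h).
    have e1 : K u = c *: (P u - K h).
      by rewrite Pu Tu (linearD K) (linearZ_LR K) addrAC subrr add0r scalerA cl scale1r.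
    have e2 : u - P u = - (c *: (h - P h)).
      have : l *: (u - P u) = - (h - P h).
        move: Pw; rewrite Tu (linearD P) (linearZ_LR P) => Pw.
        by apply/eqP; rewrite scalerBr opprB subr_eq addrAC Pw [h + _]addrC addrK.
      by move=> /(congr1 (fun x => c *: x)); rewrite scalerA cl scale1r scalerN.
    rewrite e1 -scalerBr; congr (_ *: _).
    by rewrite addrAC -(opprB u (P u)) e2 opprK.
  apply: le_trans (hB u) _; rewrite Ku rnormZ -/q.
  apply: (@le_trans _ _ (`|B| * (q * rnorm (c *: (h - P h) - K h)))).
    by rewrite ler_wpM2r ?ler_norm// mulr_ge0 ?rnorm_ge0.
  rewrite -!mulrA ler_wpM2l// ler_wpM2l//.
  apply: le_trans (rnormD _ _) _; rewrite rnormN rnormZ -/q mulrDl -mulrA lerD//.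
    rewrite ler_wpM2l//; apply: le_trans (rnormD _ _) _; rewrite rnormN.
    by have := Pb h; lra.
  by apply: le_trans (Kb h) _; rewrite ler_wpM2r ?rnorm_ge0// ler_norm.
move=> h; have [u hu] := hsurj (- (c *: (K h - c *: (h - P h)))).
have [Du Tu] : op_dom T u /\ T u = h + l *: u.
  have uE : u = l *: K u + K h - c *: (h - P h).
    have : c *: u = K u + c *: (K h - c *: (h - P h)).
      by apply/eqP; rewrite eq_sym -subr_eq0 addrAC hu addNr.
    move=> /(congr1 (fun x => l *: x)); rewrite scalerA lc scale1r scalerDr scalerA lc scale1r.
    by rewrite addrA.
  have Pu : P u = l *: K u + K h.
    by rewrite {1}uE (linearB P) (linearD P) !(linearZ_LR P) !PK (linearB P) PP subrr scaler0 subr0.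
  apply/hT; split.
    rewrite (linearD P) (linearZ_LR P) Pu {2}uE.
    set a := _ + K h; rewrite scalerBr [l *: (c *: _)]scalerA lc scale1r opprB.
    by rewrite [RHS]addrCA [h + _]addrC subrK addrC.
  by rewrite Pu (linearD K) (linearZ_LR K) addrC.
by exists u; rewrite Tu addrK.
Qed.

(** If [P] is injective it is the identity, and then [T] is the inverse of [K]. *)
Lemma resolvent_zero : (forall x, P x = 0 -> x = 0) -> resolvent_set T 0.
Proof.
move=> hP; have Pid x : P x = x.
  by apply/eqP; rewrite eq_sym -subr_eq0; apply/eqP/hP; rewrite linearB/= PP subrr.
have [C Kb] := cp_bounded hK.
apply: (@resolvent_of 0 C) => [u Du|h].
  have [_ Pu] := (hT u _).1 (conj Du erefl).
  by rewrite scale0r subr0 -{1}(Pid u) Pu Kb.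
have [Du Tu] : op_dom T (K h) /\ T (K h) = h by apply/hT; rewrite !Pid.
by exists (K h); rewrite scale0r subr0.
Qed.

Lemma krein_spectrum (l : R[i]) : spectrum T l ->
  op_eigenvalue T l /\
  (l = 0 \/ exists2 k : R, 0 < k & l = (k^-1)%:C /\ exists2 x, x != 0 & K x = k%:C *: x).
Proof.
move=> hl; have [l0|l0] := eqVneq l 0.
  rewrite l0 in hl *; split; last by left.
  have [x [Px x0]] : exists x, P x = 0 /\ x != 0.
    apply: contrapT => h; apply: hl; apply: resolvent_zero => x Px.
    by apply/eqP/negPn/negP => x0; apply: h; exists x.
  exists x => //; rewrite /op_eigenspace/= scale0r; apply/hT.
  by rewrite !linear0.
have [x [Kx x0]] : exists x, K x = l^-1 *: x /\ x != 0.
  apply: contrapT => h; apply: hl; apply: resolvent_nonzero => // x Kx.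
  by apply/eqP/negPn/negP => x0; apply: h; exists x.
split; first by exists x => //; rewrite krein_eigenspace.
right; have := eigen_ge0 hdot hK x0 Kx; rewrite le0r invr_eq0 (negPf l0)/= => lp.
have lE : l^-1 = (complex.Re l^-1)%:C by rewrite RRe_real// gtr0_real.
exists (complex.Re l^-1); first by move: lp; rewrite {1}lE ltcR.
by split; [rewrite fmorphV/= -lE invrK|exists x => //; rewrite -lE].
Qed.

Variables (kap : nat -> R) (e : nat -> H).
Hypothesis hE : eigensystem dot K kap e.

Lemma krein_spectrum_listed (l : R[i]) : spectrum T l ->
  l = 0 \/ exists2 i, 0 < kap i & l = ((kap i)^-1)%:C.
Proof.
move=> /krein_spectrum[_ [|[k k0 [-> [x x0 Kx]]]]]; first by left.
right; have [i ki] := eigen_listed hdot hK hE k0 x0 Kx.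
by exists i; rewrite ki.
Qed.

Lemma krein_spectrum_ge0 (l : R[i]) : spectrum T l -> 0 <= l.
Proof. by move=> /krein_spectrum_listed[->//|[i k0 ->]]; rewrite ler0c invr_ge0 ltW. Qed.

(** Spectral points at distance less than [1] from [l] are [0] or some
    [1 / kap i] below [l + 1]; the latter have [i < N] as soon as
    [kap N < 1 / (l + 1)]. *)
Lemma krein_spectrum_isolated (l : R[i]) : spectrum T l -> isolated (spectrum T) l.
Proof.
move=> hl; split; first by rewrite inE.
have lE : l = (complex.Re l)%:C by rewrite RRe_real// ger0_real// krein_spectrum_ge0.
set r := complex.Re l in lE.
have r0 : 0 <= r by rewrite -ler0c -lE krein_spectrum_ge0.
have r1 : 0 < r + 1 by rewrite ltr_wpDl.
have rp : 0 < (r + 1)^-1 by rewrite invr_gt0.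
have [N hN] := kap_small hdot hK hE rp.
have [d d0 hd] := finite_gap (0 :: [seq (kap i)^-1 | i <- iota 0 N]) r.
exists (ball (l : R[i]^o) (Order.min d 1)%:C).
  by apply: nbhsx_ballx; rewrite ltcR lt_min d0 ltr01.
apply/seteqP; split=> [l' [bl' sl']|_ ->]; last first.
  by split=> //; apply: ballxx; rewrite ltcR lt_min d0 ltr01.
have [s ls sE] : exists2 s : R, l' = s%:C & s = 0 \/ exists2 i, 0 < kap i & s = (kap i)^-1.
  have [->|[i k0 ->]] := krein_spectrum_listed sl'; first by exists 0 => //; left.
  by exists (kap i)^-1 => //; right; exists i.
move: bl'; rewrite -ball_normE/= ls lE -rmorphB normc_def/= expr0n/= addr0 sqrtr_sqr ltcR lt_min.
rewrite distrC => /andP[sd s1].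
apply: congr1; apply/eqP/negPn/negP => sr.
suff /hd/(_ sr) : s \in 0 :: [seq (kap i)^-1 | i <- iota 0 N] by rewrite leNgt sd.
case: sE => [->|[i k0 sE]]; first by rewrite in_cons eqxx.
rewrite in_cons; apply/orP; right; apply/mapP; exists i => //.
rewrite mem_iota/= add0n ltnNge; apply/negP => Ni.
have := le_lt_trans (kap_anti hdot hE Ni) hN.
have : s < r + 1 by move: s1; rewrite ltr_norml => /andP[]; lra.
by rewrite sE -{1}[r + 1]invrK ltf_pV2 ?posrE ?invr_gt0// => /lt_trans h1 /h1; rewrite ltxx.
Qed.

End KreinSpectrum.

(** * The minimax quotient *)

Section MinMax.
Context {R : realType} {H : completeNormedModType R[i]}.
Variable dot : {dot H for Num.conj}.
Hypothesis hdot : induces_norm dot.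
Implicit Types (x y z f g u w h : H) (M F : set H).
Variable S : operator H.
Hypothesis hlin : linear_operator S.
Hypothesis hsym : symmetric_operator dot S.
Hypothesis hdense : densely_defined S.
Variable mu : R.
Hypothesis mu0 : 0 < mu.
Hypothesis hlow : forall f, op_dom S f -> mu * rnorm f ^+ 2 <= rdot dot (S f) f.
Hypothesis hcompact : compact_embedding S.
Local Notation D := (op_dom S).
Local Notation ranS := [set S f | f in D].

Definition quotient f : R := rnorm (S f) ^+ 2 / rdot dot (S f) f.

Lemma quotientE f : D f -> `|S f| ^+ 2 / dot (S f) f = (quotient f)%:C.
Proof.
move=> Df; rewrite /quotient rmorphM/= rmorphXn/= -rnormE fmorphV/=; congr (_ / _).
have : dot (S f) f = (dot (S f) f)^*%C by rewrite {1}hsym// dotC.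
rewrite /rdot; case: (dot (S f) f) => a b /(congr1 (@complex.Im _)) /= /eqP.
by rewrite -addr_eq0 -mulr2n mulrn_eq0 => /eqP ->.
Qed.

(** Minimize [(S f, f)] under [|S f| = 1].  By the compact embedding, a minimizing
    sequence has a subsequence that converges in [H]; on [F], [S] agrees with a
    bounded finite-rank operator [L], so the images under [S] converge as well. *)
Lemma quotient_max F n : (0 < n)%N -> F `<=` D -> has_dim F n ->
  exists2 f, F f /\ f != 0 & forall g, F g -> g != 0 -> quotient g <= quotient f.
Proof.
move=> n0 FD [v [iv FE]].
have Dv i : D (v i) by apply: FD; rewrite FE; exact: lin_span_mem.
have SF : subspace F by rewrite FE; exact: lin_span_subspace.
have cF : seq_closed F by rewrite FE; exact: (lin_span_closed hdot).
have [w vw] := dual_family hdot iv.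
have [L [C [LE LC]]] := finite_rank hdot (fun i => S (v i)) w.
have LS f : F f -> L f = S f.
  rewrite FE => /(dual_expand vw) fE; rewrite LE {2}fE.
  by have [_ ->] := op_sum hlin (fun i => dot f (w i)) Dv.
have normal g : F g -> g != 0 ->
    F ((rnorm (S g))^-1%:C *: g) /\ rnorm (S ((rnorm (S g))^-1%:C *: g)) = 1.
  move=> Fg g0; split; first exact: subspaceZ.
  have Sg : 0 < rnorm (S g).
    have := op_pos mu0 hlow (FD _ Fg) g0; rewrite lt0r => /andP[/eqP h _].
    rewrite rnorm_gt0; apply/eqP => Sg0; apply: h.
    by rewrite Sg0; apply: rdot_eq0; exact: linear0l.
  by rewrite (opZ hlin); [rewrite rnormZr gtr0_norm ?invr_gt0// mulVf// lt0r_neq0|exact: FD].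
pose B := [set rdot dot (S f) f | f in [set f | F f /\ rnorm (S f) = 1]].
have B0 : B !=set0.
  have [f Ff f0] : exists2 f, F f & f != 0.
    exists (v (Ordinal n0)); first by rewrite FE; exact: lin_span_mem.
    apply/eqP => v0; have := iv (fun i => (i == Ordinal n0)%:R).
    rewrite (bigD1 (Ordinal n0))//= v0 scaler0 big1 ?addr0 => [/(_ erefl (Ordinal n0))|i /negPf ->].
      by rewrite eqxx => /eqP; rewrite oner_eq0.
    by rewrite scale0r.
  by have h := normal f Ff f0; eexists; exists ((rnorm (S f))^-1%:C *: f).
have lB : has_lbound B.
  exists 0 => _ [f [Ff _] <-]; apply: le_trans (hlow (FD _ Ff)).
  by rewrite mulr_ge0 ?sqr_ge0// ltW.
have /choice[u hu] : forall n : nat, exists f,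
    [/\ F f, rnorm (S f) = 1 & rdot dot (S f) f < inf B + n.+1%:R^-1].
  move=> m; have [|_ [f [Ff Sf] <-] hf] := @inf_adherent _ B m.+1%:R^-1 _ (conj B0 lB).
    by rewrite invr_gt0 ltr0Sn.
  by exists f.
have [|phi [f [hphi uf]]] := @precompact_subseq _ _ _ u hcompact.
  move=> m; have [Fu Su _] := hu m; split; first exact: FD.
  by rewrite rnormE Su.
have Ff : F f by apply: seq_closed_cvg uf => // m /=; case: (hu (phi m)).
have Luf : (fun m => S (u (phi m))) @ \oo --> S f.
  rewrite -LS//; have -> : (fun m => S (u (phi m))) = fun m => L ((u \o phi) m).
    by apply/funext => m; rewrite LS//; case: (hu (phi m)).
  exact: cvg_bdd_linear uf.
have Sf : rnorm (S f) = 1 by apply: (cvg_const (cvg_rnorm Luf)) => m; case: (hu (phi m)).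
have bf : rdot dot (S f) f <= inf B.
  apply: (cvg_seq_le (cvg_rdot hdot Luf uf)
    (_ : (fun m => inf B + (phi m).+1%:R^-1) @ \oo --> inf B)).
    rewrite -[X in _ --> X]addr0; apply: cvgD; first exact: cvg_cst.
    exact: (cvg_subseq hphi (@cvg_harmonic R)).
  by move=> m /=; case: (hu (phi m)) => _ _ /ltW.
have f0 : f != 0.
  apply/eqP => f0; move: Sf; rewrite f0 (op0 hlin) rnorm0 => /eqP.
  by rewrite eq_sym oner_eq0.
have bp := op_pos mu0 hlow (FD _ Ff) f0.
exists f => // g Fg g0; rewrite /quotient Sf expr1n mul1r.
have bg := op_pos mu0 hlow (FD _ Fg) g0.
have [Fg' Sg'] := normal g Fg g0.
have : inf B <= rdot dot (S ((rnorm (S g))^-1%:C *: g)) ((rnorm (S g))^-1%:C *: g).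
  by apply: ge_inf => //; exists ((rnorm (S g))^-1%:C *: g).
rewrite (opZ hlin)//; last exact: FD.
rewrite (rdotZl dot) (rdotZr dot) => /(le_trans bf) h.
have Sg : 0 < rnorm (S g).
  rewrite lt0r rnorm_ge0 andbT; apply/eqP => Sg0.
  move: Sg'; rewrite Sg0 (opZ hlin) ?invr0 ?scale0r ?rnorm0; last exact: FD.
  by move=> /eqP; rewrite eq_sym oner_eq0.
rewrite ler_pdivrMr// ler_pdivlMl// -ler_pdivlMr ?exprn_gt0//.
by apply: le_trans h _; rewrite mulrA -invfM -expr2 mulrC.
Qed.

Variables (P K : {linear H -> H}).
Hypothesis hP : is_proj dot ranS P.
Hypothesis KS : forall f, D f -> K (S f) = P f.
Hypothesis PK : forall x, P (K x) = K x.
Variables (kap : nat -> R) (e : nat -> H).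
Hypothesis hE : eigensystem dot K kap e.
Local Notation Ke := (es_eigen hE).
Local Notation kap_ge0 := (es_ge0 hE).
Local Notation e_norm := (es_norm hE).
Local Notation kap_max := (es_max hE).

Lemma form_compression f : D f -> rdot dot (K (S f)) (S f) = rdot dot (S f) f.
Proof.
move=> Df; rewrite KS// /rdot (proj_dotl hP); last by exists f.
by rewrite hsym.
Qed.

(** An eigenvector for a positive eigenvalue is in the range of [K], hence in
    that of [P]. *)
Lemma ran_e : exists fe : nat -> H, forall i, D (fe i) /\ S (fe i) = e i.
Proof.
suff /choice[fe hfe] : forall i, exists f, D f /\ S f = e i by exists fe.
move=> i; suff [f Df Sf] : ranS (e i) by exists f.
have := kap_ge0 i; rewrite le_eqVlt => /orP[/eqP k0|kp].
  by rewrite (e_norm i).1//; case: (ran_subspace hlin).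
have -> : e i = (kap i)^-1%:C *: K (e i).
  by rewrite Ke scalerA -rmorphM mulVf ?lt0r_neq0// rmorph1 scale1r.
apply: subspaceZ; first exact: (ran_subspace hlin).
by rewrite -PK; exact: (proj_in hP).
Qed.

Lemma ran_e_indep n (fe : nat -> H) : (forall i, D (fe i) /\ S (fe i) = e i) ->
  (forall m, (m < n)%N -> 0 < kap m) -> lin_indep (fun m : 'I_n => fe m).
Proof.
move=> hfe kp c h.
have := op_sum hlin c (fun m : 'I_n => (hfe m).1); rewrite h (op0 hlin) => -[_ h2].
have h3 : \sum_(m < n) c m *: e m = 0.
  by rewrite [RHS]h2; apply: eq_bigr => m _; case: (hfe m) => _ ->.
apply: (e_indep hdot hE (f := fun m : 'I_n => val m) _ _ h3); first exact: val_inj.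
by move=> m; exact: kp (ltn_ord m).
Qed.

(** If [kap n = 0], then for [f] in [dom S] the remainder of the expansion of
    [S f] along [e 0, ..., e (n - 1)] is [S g] with [(S g, g) = 0], so [g = 0].
    Hence [dom S] has dimension at most [n]; being dense and closed it is [H]. *)
Lemma index_kap i : index_upto_dim H i.+1 <-> 0 < kap i.
Proof.
split=> [[_ hj]|ki]; last first.
  split=> // n [v [iv vT]].
  apply: (@lin_indep_leq _ _ _ _ (fun m : 'I_i.+1 => e m) v); last by move=> m; rewrite -vT.
  apply: (e_indep hdot hE (f := fun m : 'I_i.+1 => val m)) => [|m]; first exact: val_inj.
  apply: lt_le_trans ki _; apply: (kap_anti hdot hE).
  exact: ltn_ord m.
have [//|ki] := ltP 0 (kap i).
have ex0 : exists n, kap n == 0 by exists i; rewrite eq_le ki kap_ge0.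
case: (ex_minnP ex0) => n /eqP kn nmin.
have kp m : (m < n)%N -> 0 < kap m.
  move=> mn; rewrite lt0r kap_ge0 andbT; apply/negP => /nmin; by rewrite leqNgt mn.
have [fe hfe] := ran_e.
pose v (m : 'I_n) := fe m.
have Dv m : D (v m) by case: (hfe m).
have iv : lin_indep v by exact: ran_e_indep hfe kp.
have DS f : D f -> lin_span v f.
  move=> Df; exists (fun m : 'I_n => dot (S f) (e m)).
  apply/eqP; rewrite -subr_eq0; apply/negPn/negP.
  have [Ds Ss] := op_sum hlin (fun m : 'I_n => dot (S f) (e m)) Dv.
  set g := f - _ => g0; have Dg : D g by apply: subspaceB => //; exact: dom_subspace.
  have := op_pos mu0 hlow Dg g0; rewrite -form_compression// ltNge => /negP; apply.
  have /kap_max : forall m, (m < n)%N -> dot (S g) (e m) = 0; last by rewrite kn mul0r.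
  move=> m mn; rewrite (opB hlin)// Ss.
  have -> : \sum_(j < n) dot (S f) (e j) *: S (v j) = \sum_(j < n) dot (S f) (e j) *: e j.
    by apply: eq_bigr => j _; case: (hfe j) => _ ->.
  exact: (expansion_orth hdot hE).
have := hj n _; rewrite ltnNge nmin ?eq_le ?ki ?kap_ge0//; apply.
exists v; split=> //; apply/seteqP; split=> // x _.
apply: (lin_span_closed hdot iv) => d d0.
have [y Dy xy] := dense_closure_pt x hdense d0.
by exists y => //; exact: DS.
Qed.

(** With [x = S f = sum_m c_m e_m], the form [(K x, x) = sum_m kap m |c_m|^2]
    dominates [kap i |x|^2], as [kap m >= kap i] for [m <= i]. *)
Lemma quotient_le_span i c (fe : nat -> H) : 0 < kap i ->
  (forall i, D (fe i) /\ S (fe i) = e i) ->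
  let f := \sum_(m < i.+1) c m *: fe m in f != 0 -> quotient f <= (kap i)^-1.
Proof.
move=> ki hfe f f0.
have [Df Sf] := op_sum hlin c (fun m : 'I_i.+1 => (hfe m).1).
have bp := op_pos mu0 hlow Df f0.
rewrite /quotient ler_pdivrMr// ler_pdivlMl// -form_compression//.
set x := S f; rewrite -subr_ge0.
have xE : x = \sum_(m < i.+1) c m *: e m.
  by rewrite /x Sf; apply: eq_bigr => m _; case: (hfe m) => _ ->.
have kle (m : 'I_i.+1) : kap i <= kap m.
  by apply: (kap_anti hdot hE); exact: ltn_ord m.
have cE (m : 'I_i.+1) : dot (e m) x = (c m)^*%C.
  rewrite dotC xE dot_suml (bigD1 m)//= dotZl (e_dot1 hdot hE) ?(lt_le_trans ki)// mulr1.
  rewrite big1 ?addr0// => j jm; rewrite dotZl (e_dot hE) ?mulr0//.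
have : 0 <= dot (K x) x - (kap i)%:C * dot x x.
  have -> : dot (K x) x = \sum_(m < i.+1) (kap m)%:C * (c m * (c m)^*%C).
    rewrite {1}xE linear_sum dot_suml; apply: eq_bigr => m _.
    by rewrite (linearZ_LR K) Ke !dotZl cE mulrCA.
  have -> : dot x x = \sum_(m < i.+1) (c m * (c m)^*%C).
    by rewrite {1}xE dot_suml; apply: eq_bigr => m _; rewrite dotZl cE.
  rewrite mulr_sumr -sumrB; apply: sumr_ge0 => m _.
  by rewrite -mulrBl mulr_ge0 ?mulcJ_ge0// -rmorphB ler0c subr_ge0.
rewrite (dotxx hdot) lecE => /andP[_] /=.
by rewrite /rdot; case: (dot (K x) x) => a b /=; rewrite mul0r subr0.
Qed.

(** The [i] linear conditions of orthogonality of [S f] to [e 0, ..., e (i - 1)]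
    have a nonzero solution [f] in a space of dimension [i + 1]. *)
Lemma quotient_span_ge i F : 0 < kap i -> F `<=` D -> has_dim F i.+1 ->
  exists2 f, F f /\ f != 0 & (kap i)^-1 <= quotient f.
Proof.
move=> ki FD [v [iv FE]].
have Dv m : D (v m) by apply: FD; rewrite FE; exact: lin_span_mem.
have [c c0 cA] := left_kernel (\matrix_(m < i.+1, l < i) dot (S (v m)) (e l)) (ltnSn i).
pose f := \sum_(m < i.+1) c 0 m *: v m.
have [Df Sf] := op_sum hlin (fun m => c 0 m) Dv.
have f0 : f != 0 by apply/eqP => /(lin_indep_row iv) c00; rewrite c00 eqxx in c0.
exists f; first by split=> //; rewrite FE; exists (fun m => c 0 m).
have bp := op_pos mu0 hlow Df f0.
rewrite /quotient ler_pdivlMr// ler_pdivrMl// -form_compression//.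
apply: kap_max => l li; rewrite Sf dot_suml.
have := congr1 (fun A : 'rV[R[i]]_i => A 0 (Ordinal li)) cA; rewrite !mxE => h; rewrite -[RHS]h.
by apply: eq_bigr => m _; rewrite dotZl mxE.
Qed.

End MinMax.

(** * The theorem *)

(** The indices of the eigenvalues start at [1], those of [kap] at [0]. *)
Lemma card_shift (A : set nat) (a n : nat) :
  (forall j, A j <-> exists2 i, (i < n)%N & j = (a + i).+1) -> (A #= `I_n)%card.
Proof.
move=> hA; rewrite card_eq_sym; apply/card_set_bijP; exists (fun i => (a + i).+1); split.
- by move=> i /= ni; apply/hA; exists i.
- by move=> i j _ _ [/addnI].
- by move=> j /hA[i ni ->]; exists i.
Qed.

Theorem theorem2p4 (R : realType) (H : completeNormedModType R[i])
    (dot : {dot H for Num.conj}) (hdot : induces_norm dot)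
    (hsep : separable_space H)
    (S : operator H) (hlin : linear_operator S)
    (hclosed : closed_operator S) (hsym : symmetric_operator dot S)
    (hdense : densely_defined S)
    (hpos : exists mu : R[i], 0 < mu /\ lower_bounded dot S mu)
    (hcompact : compact_embedding S) :
  [/\ forall l : R[i], spectrum (krein_von_neumann dot S) l -> 0 <= l,
      forall l : R[i], spectrum (krein_von_neumann dot S) l ->
        isolated (spectrum (krein_von_neumann dot S)) l /\
        op_eigenvalue (krein_von_neumann dot S) l,
      forall l : R[i], 0 < l -> op_eigenvalue (krein_von_neumann dot S) l ->
        exists n : nat, has_dim (op_eigenspace (krein_von_neumann dot S) l) n
    & exists lam : nat -> R[i],
        enumerates_positive_eigenvalues (krein_von_neumann dot S)
          (index_upto_dim H) lam /\
        forall j : nat, index_upto_dim H j ->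
          (forall F : set H, F `<=` op_dom S -> has_dim F j ->
             exists m, is_max (quotients dot S F) m) /\
          is_min [set m | exists F : set H,
                    [/\ F `<=` op_dom S, has_dim F j
                      & is_max (quotients dot S F) m]]
                 (lam j)].
Proof.
have [mu mu0 hlow] : exists2 mu : R, 0 < mu &
    forall f, op_dom S f -> mu * rnorm f ^+ 2 <= rdot dot (S f) f.
  have [mu [mup hmu]] := hpos; exists (complex.Re mu).
    by rewrite -ltcR RRe_real// gtr0_real.
  move=> f Df; have := hmu f Df.
  rewrite rnormE -(RRe_real (gtr0_real mup)) -rmorphXn -rmorphM lecE => /andP[_].
  by rewrite /rdot.
have [P [K [hP KS PK hK]]] :=
  compression hdot hlin hclosed hsym mu0 hlow hcompact.
have [kap [e hE]] := spectral_sequence hdot hK.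
have hT := krein_graph hdot hlin hsym hdense hP KS.
set T := krein_von_neumann dot S in hT *.
have PP x : P (P x) = P x by rewrite (projK hdot (ran_subspace hlin) hP).
have Pb x : rnorm (P x) <= rnorm x by exact: proj_rnorm hP x.
have anti := kap_anti hdot hE.
have idx := index_kap hdot hlin hsym hdense mu0 hlow hP KS PK hE.
(* The [j]-th positive eigenvalue is [1 / kap (j - 1)]; the block [a <= i < b]
   of indices with [kap i = 1 / l] has the dimension of the eigenspace. *)
have mult (l : R[i]) : 0 < l -> exists n, has_dim (op_eigenspace T l) n /\
    ([set j | index_upto_dim H j /\ (kap j.-1)^-1%:C = l] #= `I_n)%card.
  move=> lp; have lE : l = (complex.Re l)%:C by rewrite RRe_real// gtr0_real.
  set r := complex.Re l in lE.
  have r0 : 0 < r by rewrite lE ltcR in lp.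
  have ri0 : 0 < r^-1 by rewrite invr_gt0.
  have [a [b [ab hk kb]]] := eigen_block hdot hK hE ri0.
  have [iv sp] := eigenspace_span hdot hK hE ri0 ab hk kb.
  exists (b - a)%N; split.
    exists (fun i : 'I_(b - a) => e (a + i)%N); split=> //.
    by rewrite (krein_eigenspace PK hT) ?lt0r_neq0// -sp lE -fmorphV.
  apply: (card_shift (a := a)) => -[|j]; first by split=> [[[]//]|[]].
  rewrite /= lE; split=> [[_ /complexI kj]|[i ni [->]]].
    have /hk/andP[aj jb] : kap j = r^-1 by rewrite -kj invrK.
    by exists (j - a)%N; [rewrite ltn_sub2r// (leq_ltn_trans aj)|rewrite subnKC].
  have ki : kap (a + i)%N = r^-1 by apply/hk; rewrite leq_addr/= -ltn_subRL.
  by rewrite ki invrK; split=> //; apply/idx; rewrite ki.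
have hsp := krein_spectrum hdot PP Pb PK hK hT.
split.
- exact: (krein_spectrum_ge0 hdot PP Pb PK hK hT hE).
- move=> l hl; split; last by case: (hsp l hl).
  exact: (krein_spectrum_isolated hdot PP Pb PK hK hT hE).
- by move=> l lp _; have [n [hn _]] := mult l lp; exists n.
exists (fun j => (kap j.-1)^-1%:C); split.
  split=> [[|j]|[|i] [|j]|]; try by case.
  - by move=> /idx kj; rewrite ltcR invr_gt0.
  - by move=> /idx ki /idx kj ij; rewrite lecR lef_pV2// anti.
  - exact: mult.
have qE F f : F `<=` op_dom S -> F f -> `|S f| ^+ 2 / dot (S f) f = (quotient dot S f)%:C.
  by move=> FD Ff; have := quotientE hsym (FD _ Ff).
move=> [[]//|i /idx ki /=]; split=> [F FD hF|].
  have [f [Ff f0] hf] := quotient_max hdot hlin mu0 hlow hcompact (ltn0Sn i) FD hF.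
  exists (quotient dot S f)%:C; split; first by exists f; [split|have := qE F f FD Ff].
  by move=> _ [g [Fg g0] <-]; rewrite (qE F)// lecR hf.
split=> [|m [F [FD hF [_ ubm]]]]; last first.
  have [f [Ff f0] hf] := quotient_span_ge hlin hsym mu0 hlow hP KS hE ki FD hF.
  apply: le_trans (ubm (quotient dot S f)%:C _); first by rewrite lecR.
  by exists f; [split|have := qE F f FD Ff].
have [fe hfe] := ran_e hlin hP PK hE.
pose v (m : 'I_i.+1) := fe m.
have FD : lin_span v `<=` op_dom S.
  by move=> _ [c ->]; exact: (op_sum hlin c (fun m : 'I_i.+1 => (hfe m).1)).1.
have kp m : (m < i.+1)%N -> 0 < kap m.
  by move=> mi; apply: lt_le_trans ki (anti _ _ _).
(* The minimum is attained on the span of the preimages of [e 0, ..., e i]. *)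
exists (lin_span v); split=> //; first by exists v; split=> //;
  exact: (ran_e_indep hdot hlin hE hfe kp).
have e1 : rnorm (e i) = 1 by exact: (es_norm hE i).2.
split.
  exists (fe i); last rewrite (qE (lin_span v))//.
  - split; first exact: (lin_span_mem v ord_max).
    apply/eqP => fe0; have [_] := hfe i; rewrite fe0 (op0 hlin) => ei0.
    by move/eqP: e1; rewrite -ei0 rnorm0 eq_sym oner_eq0.
  - congr _%:C; rewrite /quotient -(form_compression hsym hP KS); last by case: (hfe i).
    have [_ ->] := hfe i; rewrite (es_eigen hE) (rdotZl dot) (rdotxx hdot) e1 expr1n mulr1 mul1r//.
  - exact: (lin_span_mem v ord_max).
move=> _ [g [Fg g0] <-]; rewrite (qE (lin_span v))// lecR.
have [c gE] := Fg; rewrite gE in g0 *.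
exact: (quotient_le_span hdot hlin hsym mu0 hlow hP KS hE ki hfe).
Qed.
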